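(* There are isomorphisms of algebras: - If $r\in3+2\mathbb N$: $\mathbb A_{\bar0}\cong A^{\frac{r-1}{2}}\times\mathbb C\cong\mathbb A_{\bar1}$. - If $r\in2+4\mathbb N$: $\mathbb A_{\bar0}\cong A^{\frac{r-2}{4}}\times B$ and $\mathbb A_{\bar1}\cong A^{\frac{r-2}{4}}\times\mathbb C$. - If $r\in4+4\mathbb N$: $\mathbb A_{\bar0}\cong A^{\frac r4}$ and $\mathbb A_{\bar1}\cong A^{\frac{r-4}{4}}\times B\times\mathbb C$. Here $A^n$ denotes the product of $n$ copies of $A$.
   Context: Fix a positive integer $r$. Let $r'=r$ if $r$ is odd and $r'=r/2$ if $r$ is even. Set $q=e^{\pi\sqrt{-1}/r}$, $q^x=e^{\pi\sqrt{-1}x/r}$, $\{x\}=q^x-q^{-x}$, $[x]=\{x\}/\{1\}$. $\overline U=\overline U_q^H\mathfrak{sl}(2)$ is the Hopf algebra over $\mathbb C$ generated by $E,F,K,K^{-1},H$ with: - relations $KK^{-1}=K^{-1}K=1$, $KEK^{-1}=q^2E$, $KFK^{-1}=q^{-2}F$, $EF-FE=\frac{K-K^{-1}}{q-q^{-1}}$, $HK=KH$, $[H,E]=2E$, $[H,F]=-2F$, $E^r=F^r=0$; - coproduct $\Delta(E)=1\otimes E+E\otimes K$, $\Delta(F)=K^{-1}\otimes F+F\otimes1$, $\Delta(K)=K\otimes K$, $\Delta(H)=H\otimes1+1\otimes H$. Weight modules: $H$ diagonalizable and $K=q^\lambda$ on weight-$\lambda$ vectors. $\mathbb C^H_{kr}$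 is the one-dimensional module with $E=F=0$ and $H=kr$. Definition of $P_i$, for $i\in\{0,\dots,r-2\}$ (write $j=r-2-i$ and $\gamma_{n,k}=[k][n-k+1]$). $P_i$ has basis $h_m$ ($m=i,i-2,\dots,-i$), $s_m$ ($m=i,\dots,-i$), $R_m$ ($m=r+j,\dots,r-j$), $L_m$ ($m=j-r,\dots,-j-r$), each of weight $m$, with: - $Fh_m=h_{m-2}$ ($m>-i$), $Fh_{-i}=L_{j-r}$; - $Fs_m=s_{m-2}$ ($m>-i$), $Fs_{-i}=0$; - $FL_m=L_{m-2}$ ($m>-j-r$), $FL_{-j-r}=0$; - $FR_{r-j}=s_i$, $FR_{r-j+2k}=-\gamma_{j,k}R_{r-j+2k-2}$ ($1\le k\le j$); - $Eh_i=R_{r-j}$, $Eh_{i-2k}=\gamma_{i,k}h_{i-2k+2}+s_{i-2k+2}$; - $Es_i=0$, $Es_{i-2k}=\gamma_{i,k}s_{i-2k+2}$; - $ER_m=R_{m+2}$ ($m<r+j$), $ER_{r+j}=0$; - $EL_{j-r}=s_{-i}$, $EL_{j-2k-r}=-\gamma_{j,k}L_{j-2k-r+2}$. $P_{r-1}$ is the $r$-dimensional simple module of highest weight $r-1$. The module $\mathbb P$. Let $\mathbb P=\bigoplus_{k\in\mathbb Z}\bigoplus_{i=0}^{r-1}\mathbb C^H_{kr}\otimes P_i$, an infinite-dimensional weight module with finite-dimensional weight spaces. - It is $\mathbb Z$-graded by giving the summand $\mathbb C^H_{kr}\otimes P_i$ degree $k$. - For $\nu\in\{\bar0,\bar1\}$,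 $\mathbb P_\nu$ is the sum of the weight spaces with weights in $\nu+2\mathbb Z$, so $\mathbb P=\mathbb P_{\bar0}\oplus\mathbb P_{\bar1}$. - Let $\sigma=\mathbb C^H_{2r'}$. The canonical isomorphisms $\sigma\otimes\mathbb C^H_{kr}\otimes P_i\cong\mathbb C^H_{kr+2r'}\otimes P_i$ ($1\otimes1\otimes v\mapsto1\otimes v$) define an action of $\mathbb Z$ on $\mathbb P$. - $\mathbb A_\nu=\mathrm{End}_\sigma(\mathbb P_\nu)$ is the algebra of $\overline U$-linear endomorphisms of $\mathbb P_\nu$ commuting with this action. It is $\mathbb Z$-graded: a map has degree $d$ if it sends degree $k$ to degree $k+d$. The algebras $A$ and $B$. - $A$ is the $\mathbb Z$-graded $\mathbb C$-algebra generated by orthogonal idempotents $p,q$ with $p+q=1$ and elements $a_+,a_-,b_+,b_-$ with $a_\pm=qa_\pm p$, $b_\pm=pb_\pm q$ (the path algebra of the quiver with two vertices $p,q$, arrows $a_\pm$ from $p$ to $q$ and $b_\pm$ from $q$ to $p$). The relations are $a_+b_+=b_+a_+=a_-b_-=b_-a_-=0$, $a_+b_-+a_-b_+=0$, $b_+a_-+b_-a_+=0$. Grading: $a_+,b_+$ have degree $1$, $a_-,b_-$ degree $-1$, and $p,q$ degree $0$; $A$ has basis $\{a_+,b_+,a_-,b_-,p,q,b_+a_-,a_+b_-\}$. - $B$ is the quotient of $A$ by $p=q$, $a_+=b_+$, $a_-=b_-$; that is, the exterior algebra generated by $a_+$ (degree $1$) and $a_-$ (degree $-1$) with $a_+^2=a_-^2=0$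 and $a_+a_-+a_-a_+=0$. *)

(* Defs.v *)
From mathcomp Require Import all_boot all_algebra.
From mathcomp Require Import complex.
From mathcomp Require Import Rstruct.
From Stdlib Require Reals.

Set Implicit Arguments.
Unset Strict Implicit.
Unset Printing Implicit Defensive.

Import GRing.Theory Num.Theory.
Local Open Scope ring_scope.

Definition CC : fieldType := complex Rdefinitions.R.

Definition qC (r : nat) : CC :=
  Complex (Rtrigo_def.cos (Rdefinitions.Rdiv Rtrigo1.PI (Raxioms.INR r)))
          (Rtrigo_def.sin (Rdefinitions.Rdiv Rtrigo1.PI (Raxioms.INR r))).

Definition qpow (r : nat) (x : int) : CC := qC r ^ x.

Definition qbr (r : nat) (x : int) : CC := qpow r x - qpow r (- x).
Definition qint (r : nat) (x : int) : CC := qbr r x / qbr r 1.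

Definition gam (r : nat) (n k : int) : CC := qint r k * qint r (n - k + 1).

(* The basis of P = (+)_k (+)_{i=0}^{r-1} C^H_{kr} (x) P_i.            *)
(* A basis vector is (k, i, t, m): 1 (x) (basis vector of P_i) in the  *)
(* summand of degree k, where t is the type of the basis vector and m  *)
(* its weight inside P_i:                                              *)
(*   t = 0 : h_m,  t = 1 : s_m,  t = 2 : R_m,  t = 3 : L_m   (i <= r-2) *)
(*   t = 0 : v_m  (basis of the simple module P_{r-1}).                *)

Definition B0 := (int * nat * nat * int)%type.

Definition validb (r : nat) (b : B0) : bool :=
  let '(k, i, t, m) := b in
  if (i.+2 <= r)%N then
    let j := (r - 2 - i)%N in
    if t == 0%N then (- (i%:Z) <= m <= i%:Z) && (2 %| (i%:Z - m))%Z
    else if t == 1%N then (- (i%:Z) <= m <= i%:Z) && (2 %| (i%:Z - m))%Z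
    else if t == 2%N then
      ((r - j)%N%:Z <= m <= (r + j)%N%:Z) && (2 %| ((r + j)%N%:Z - m))%Z
    else if t == 3%N then
      (- ((j + r)%N%:Z) <= m <= j%:Z - r%:Z) && (2 %| (j%:Z - r%:Z - m))%Z
    else false
  else if i.+1 == r then
    [&& t == 0%N, - (i%:Z) <= m <= i%:Z & (2 %| (i%:Z - m))%Z]
  else false.

(* weight (H-eigenvalue) of the basis vector: kr + m *)
Definition wt (r : nat) (b : B0) : int :=
  let '(k, i, t, m) := b in k * r%:Z + m.

(* b lies in P_nu (nu = false for 0bar, true for 1bar) *)
Definition inP (r : nat) (nu : bool) (b : B0) : bool :=
  validb r b && (2 %| (wt r b - nu%:Z))%Z.

(* all basis vectors of P of weight w *)
Definition wlist (r : nat) (w : int) : seq B0 :=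
  let k0 := (w %/ r%:Z)%Z in
  [seq b <- [seq (k, it.1, it.2, w - k * r%:Z)
              | k <- [seq k0 - 3 + n%:Z | n <- iota 0 7],
                it <- [seq (i, t) | i <- iota 0 r, t <- iota 0 4]]
    | validb r b].

(* action of E on a basis vector (Delta(E) = 1 (x) E + E (x) K, E = 0 on C^H_{kr}) *)
Definition Eimg (r : nat) (b : B0) : seq (CC * B0) :=
  if ~~ validb r b then [::] else
  let '(k, i, t, m) := b in
  if (i.+2 <= r)%N then
    let j := (r - 2 - i)%N in
    if t == 0%N then
      (if m == i%:Z then [:: (1, (k, i, 2%N, (r - j)%N%:Z))]
       else let kk := ((i%:Z - m) %/ 2)%Z in
            [:: (gam r i kk, (k, i, 0%N, m + 2)); (1, (k, i, 1%N, m + 2))])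
    else if t == 1%N then
      (if m == i%:Z then [::]
       else let kk := ((i%:Z - m) %/ 2)%Z in [:: (gam r i kk, (k, i, 1%N, m + 2))])
    else if t == 2%N then
      (if m < (r + j)%N%:Z then [:: (1, (k, i, 2%N, m + 2))] else [::])
    else
      (if m == j%:Z - r%:Z then [:: (1, (k, i, 1%N, - (i%:Z)))]
       else let kk := ((j%:Z - r%:Z - m) %/ 2)%Z in
            [:: (- gam r j kk, (k, i, 3%N, m + 2))])
  else
    (if m == i%:Z then [::]
     else let kk := ((i%:Z - m) %/ 2)%Z in [:: (gam r i kk, (k, i, 0%N, m + 2))]).

Definition Fimg0 (r : nat) (b : B0) : seq (CC * B0) :=
  if ~~ validb r b then [::] else
  let '(k, i, t, m) := b in
  if (i.+2 <= r)%N then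
    let j := (r - 2 - i)%N in
    if t == 0%N then
      (if - (i%:Z) < m then [:: (1, (k, i, 0%N, m - 2))]
       else [:: (1, (k, i, 3%N, j%:Z - r%:Z))])
    else if t == 1%N then
      (if - (i%:Z) < m then [:: (1, (k, i, 1%N, m - 2))] else [::])
    else if t == 2%N then
      (if m == (r - j)%N%:Z then [:: (1, (k, i, 1%N, i%:Z))]
       else let kk := ((m - (r - j)%N%:Z) %/ 2)%Z in
            [:: (- gam r j kk, (k, i, 2%N, m - 2))])
    else
      (if - ((j + r)%N%:Z) < m then [:: (1, (k, i, 3%N, m - 2))] else [::])
  else
    (if - (i%:Z) < m then [:: (1, (k, i, 0%N, m - 2))] else [::]).

(* action of F on C^H_{kr} (x) P_i : Delta(F) = K^{-1} (x) F + F (x) 1,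
   with K^{-1} = q^{-kr} on C^H_{kr} and F = 0 there *)
Definition Fimg (r : nat) (b : B0) : seq (CC * B0) :=
  let '(k, _, _, _) := b in
  [seq (qpow r (- (k * r%:Z)) * p.1, p.2) | p <- Fimg0 r b].

Definition Ecoef (r : nat) (b c : B0) : CC :=
  \sum_(p <- Eimg r b) (if p.2 == c then p.1 else 0).
Definition Fcoef (r : nat) (b c : B0) : CC :=
  \sum_(p <- Fimg r b) (if p.2 == c then p.1 else 0).

(* the Z-action: sigma = C^H_{2r'} shifts the degree k by 2r'/r *)
Definition rprime (r : nat) : nat := if odd r then r else (r %/ 2)%N.
Definition sigma_shift (r : nat) (b : B0) : B0 :=
  let '(k, i, t, m) := b in (k + ((2 * rprime r) %/ r)%N%:Z, i, t, m).

(* Linear endomorphisms of P_nu, encoded by their matrices:            *)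
(* f b c = coefficient of the basis vector c in f(b).                  *)

Definition Mat := B0 -> B0 -> CC.

Definition inEnd (r : nat) (nu : bool) (f : Mat) : Prop :=
  [/\ (* f is an endomorphism of P_nu *)
      (forall b c, ~~ (inP r nu b && inP r nu c) -> f b c = 0),
      (* f commutes with H *)
      (forall b c, (wt r c)%:~R * f b c = f b c * (wt r b)%:~R) /\
      (* f commutes with K *)
      (forall b c, qpow r (wt r c) * f b c = f b c * qpow r (wt r b)),
      (forall b d, \sum_(c <- wlist r (wt r b)) f b c * Ecoef r c d
                   = \sum_(c <- wlist r (wt r b + 2)) Ecoef r b c * f c d),
      (forall b d, \sum_(c <- wlist r (wt r b)) f b c * Fcoef r c d
                   = \sum_(c <- wlist r (wt r b - 2)) Fcoef r b c * f c d)
    &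
      (forall b c, f (sigma_shift r b) (sigma_shift r c) = f b c)].

Record AlgOps := MkAlgOps {
  ao_car :> Type;
  ao_add : ao_car -> ao_car -> ao_car;
  ao_mul : ao_car -> ao_car -> ao_car;
  ao_scl : CC -> ao_car -> ao_car;
  ao_one : ao_car }.

(* operations of End(P_nu); the product is composition (f * g = f o g) *)
Definition End_ops (r : nat) (nu : bool) : AlgOps :=
  @MkAlgOps Mat
    (fun f g b c => f b c + g b c)
    (fun f g b d => \sum_(c <- wlist r (wt r b)) g b c * f c d)
    (fun a f b c => a * f b c)
    (fun b c => if inP r nu b && (b == c) then 1 else 0).

(* algebra with basis 'I_n and structure constants: tab i j = Some (neg, k)
   means  e_i e_j = (-1)^neg e_k,  tab i j = None means e_i e_j = 0 *)
Definition sc_mul (n : nat) (tab : nat -> nat -> option (bool * nat))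
    (x y : 'I_n -> CC) : 'I_n -> CC :=
  fun l => \sum_(i < n) \sum_(j < n)
    (match tab i j with
     | Some (s, k) => if k == nat_of_ord l then (if s then -1 else 1) else 0
     | None => 0 end) * (x i * y j).

Definition sc_ops (n : nat) (tab : nat -> nat -> option (bool * nat))
    (one : 'I_n -> CC) : AlgOps :=
  @MkAlgOps ('I_n -> CC) (fun x y l => x l + y l) (sc_mul tab)
    (fun a x l => a * x l) one.

(* The algebra A: basis  0 = p, 1 = q, 2 = a_+, 3 = a_-, 4 = b_+, 5 = b_-,
   6 = b_+ a_-, 7 = a_+ b_-  (paths composed right to left: a = q a p,
   b = p b q), with the relations a+b+ = b+a+ = a-b- = b-a- = 0,
   a+b- + a-b+ = 0, b+a- + b-a+ = 0. *)
Definition A_tab (i j : nat) : option (bool * nat) :=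
  match i, j with
  | 0, 0 => Some (false, 0)
  | 1, 1 => Some (false, 1)
  | 0, 4 => Some (false, 4)
  | 0, 5 => Some (false, 5)
  | 0, 6 => Some (false, 6)
  | 1, 2 => Some (false, 2)
  | 1, 3 => Some (false, 3)
  | 1, 7 => Some (false, 7)
  | 2, 0 => Some (false, 2)
  | 3, 0 => Some (false, 3)
  | 6, 0 => Some (false, 6)
  | 4, 1 => Some (false, 4)
  | 5, 1 => Some (false, 5)
  | 7, 1 => Some (false, 7)
  | 2, 5 => Some (false, 7)
  | 3, 4 => Some (true, 7)    (* a- b+ = - a+ b- *)
  | 4, 3 => Some (false, 6)
  | 5, 2 => Some (true, 6)    (* b- a+ = - b+ a- *)
  | _, _ => None
  end.

Definition A_ops : AlgOps :=
  @sc_ops 8 A_tab (fun l => if (nat_of_ord l == 0%N) || (nat_of_ord l == 1%N) then 1 else 0).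

(* The exterior algebra B: basis 0 = 1, 1 = a_+, 2 = a_-, 3 = a_+ a_-. *)
Definition B_tab (i j : nat) : option (bool * nat) :=
  match i, j with
  | 0, k => Some (false, k)
  | k, 0 => Some (false, k)
  | 1, 2 => Some (false, 3)
  | 2, 1 => Some (true, 3)
  | _, _ => None
  end.

Definition B_ops : AlgOps :=
  @sc_ops 4 B_tab (fun l => if nat_of_ord l == 0%N then 1 else 0).

Definition C_ops : AlgOps :=
  @MkAlgOps CC (fun x y => x + y) (fun x y => x * y) (fun a x => a * x) 1.

Definition prod_ops (X Y : AlgOps) : AlgOps :=
  @MkAlgOps (X * Y)%type
    (fun x y => (ao_add x.1 y.1, ao_add x.2 y.2))
    (fun x y => (ao_mul x.1 y.1, ao_mul x.2 y.2))
    (fun a x => (ao_scl a x.1, ao_scl a x.2))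
    (ao_one X, ao_one Y).

Definition pow_ops (X : AlgOps) (n : nat) : AlgOps :=
  @MkAlgOps ('I_n -> X)
    (fun x y l => ao_add (x l) (y l))
    (fun x y l => ao_mul (x l) (y l))
    (fun a x l => ao_scl a (x l))
    (fun _ => ao_one X).

Definition alg_iso_on (X : AlgOps) (S : X -> Prop) (Y : AlgOps) : Prop :=
  (S (ao_one X) /\
   forall a x y, S x -> S y ->
     [/\ S (ao_add x y), S (ao_mul x y) & S (ao_scl a x)]) /\
  exists phi : X -> Y,
      [/\ (forall x y, S x -> S y -> phi (ao_add x y) = ao_add (phi x) (phi y)) /\
          forall x y, S x -> S y -> phi (ao_mul x y) = ao_mul (phi x) (phi y),
          forall a x, S x -> phi (ao_scl a x) = ao_scl a (phi x),
          phi (ao_one X) = ao_one Y,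
          (forall x y, S x -> S y -> phi x = phi y -> x = y)
        & (forall z, exists2 x, S x & phi x = z)].

Definition Anu_iso (r : nat) (nu : bool) (Y : AlgOps) : Prop :=
  @alg_iso_on (End_ops r nu) (inEnd r nu) Y.

(* Main.v *)
(* An endomorphism f of P_nu is determined by its values on the top vectors h_i of the
   summands, since these generate.  The operator FE squares to zero on h_i, while on the
   weight spaces of each P_i' its generalized eigenvalues are +- gamma_{.,n} with n the
   distance to the top of the string, hence nonzero except on top vectors.  So f(h_i) is
   a combination of the top vectors of the right weight, of which there are only four:
   h_i and s_i in the same degree, L in P_{r-2-i} one degree up and R in P_{r-2-i} one
   degree down.  Conversely each of the four coefficients is realized by an explicit map,
   and the composition rule for these coefficients is the multiplication of A on the
   pairs {i, r-2-i}, of B when i = r-2-i, and of C when i = r-1.  The action of sigma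
   identifies all degrees k with kr + i of parity nu, so that one set of coefficients
   remains for each i. *)
From Stdlib Require Import Reals FunctionalExtensionality.
From Stdlib Require Lra Psatz.
Require Import Defs.
From mathcomp Require Import all_boot all_order all_algebra.
From mathcomp Require Import complex Rstruct.
From mathcomp Require Import zify ring.

Set Implicit Arguments.
Unset Strict Implicit.
Unset Printing Implicit Defensive.

Import GRing.Theory Num.Theory.
Local Open Scope ring_scope.

Delimit Scope R_scope with Re.

(** * Quantum integers *)

(** The relation [a_+ b_- + a_- b_+ = 0] comes from the coproduct: on the summand of degree k, [F]
    carries the sign (-1)^k by which K^{-1} acts on C^H_{kr}, while [E] carries none. A map of
    degree 1 or -1 therefore compares strings on which [F] has opposite signs. Of the two ways from
    h_i to s_i through P_{r-2-i}, the one by way of L picks up a minus and the one by way of R does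
    not. [FE] replaces the Casimir element, from which it differs by a scalar on each weight space.
    The dependence on r mod 4 is a matter of parity: i <-> r-2-i has a fixed point (r-2)/2 only for
    even r, and then the parities of (r-2)/2 and r-1 decide which algebra receives B and which
    receives C. *)

Lemma qC_exp (r n : nat) :
  qC r ^+ n = Complex (cos (INR n * (PI / INR r))%Re) (sin (INR n * (PI / INR r))%Re).
Proof.
elim: n => [|n IH]; first by rewrite expr0 /= Rmult_0_l cos_0 sin_0.
rewrite exprS IH S_INR Rmult_plus_distr_r Rmult_1_l cos_plus sin_plus.
rewrite /qC; set c1 := cos _; set s1 := sin _; set c := cos _; set s := sin _.
change (mulc (Complex c1 s1) (Complex c s) =
  Complex (c * c1 - s * s1)%Re (s * c1 + c * s1)%Re :> complex R).
rewrite /mulc -RminusE -RplusE -!RmultE.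
by congr Complex; Lra.lra.
Qed.

Lemma qC_exp_r (r : nat) : (0 < r)%N -> qC r ^+ r = -1.
Proof.
move=> r0; have r0' : INR r <> 0%Re by apply: not_0_INR; lia.
rewrite qC_exp; rewrite Rmult_div_assoc Rmult_div_r //.
rewrite cos_PI sin_PI.
change (Complex (-1)%Re 0%Re = oppc (Complex 1%Re 0%Re) :> complex R).
by rewrite /oppc -!RoppE; congr Complex; Lra.lra.
Qed.

Lemma qC_neq0 (r : nat) : (0 < r)%N -> qC r != 0.
Proof.
move=> r0; apply/eqP => q0; have := qC_exp_r r0.
rewrite q0 expr0n; case: r r0 {q0} => //= r _ /eqP.
by rewrite eq_sym oppr_eq0 oner_eq0.
Qed.

(** With y = n pi / r, the real part of q^{2n} = 1 reads cos 2y = 1, so sin y = 0; but 0 < y < pi.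
    All nonvanishing of the scalars gamma rests on this. *)
Lemma qC_exp2_neq1 (r n : nat) : (0 < n < r)%N -> qC r ^+ (n + n) != 1.
Proof.
move=> /andP[n0 nr]; apply/eqP; rewrite qC_exp.
set x := (PI / INR r)%Re.
have rp : (0 < INR r)%Re by apply: lt_0_INR; lia.
have np : (0 < INR n)%Re by apply: lt_0_INR; lia.
have nrp : (INR n < INR r)%Re by apply: lt_INR; lia.
have xp : (0 < x)%Re by apply: Rdiv_lt_0_compat => //; apply: PI_RGT_0.
have xr : (INR r * x = PI)%Re by rewrite /x Rmult_div_assoc Rmult_div_r //; Lra.lra.
have s0 : (0 < sin (INR n * x))%Re.
  apply: sin_gt_0; first exact: Rmult_lt_0_compat.
  by rewrite -xr; apply: Rmult_lt_compat_r.
move=> h; have : cos (INR (n + n) * x)%Re = 1%Re.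
  by move: h => /(congr1 (fun z : complex R => complex.Re z)).
rewrite plus_INR Rmult_plus_distr_r cos_plus.
have := sin2_cos2 (INR n * x)%Re; rewrite /Rsqr.
by move: s0; set s := sin _; set c := cos _ => s0 h1 h2; Psatz.nra.
Qed.

Lemma qbr_neq0 (r n : nat) : (0 < n < r)%N -> qbr r n%:Z != 0.
Proof.
move=> hn; have q0 : qC r != 0 by apply: qC_neq0; lia.
rewrite /qbr /qpow subr_eq0 -exprz_inv exprz_inv; apply/negP => /eqP h.
have := qC_exp2_neq1 hn; rewrite exprD.
have -> : qC r ^+ n = qC r ^ n%:Z by [].
by rewrite {1}h -expfzDr // addNr expr0z eqxx.
Qed.

Lemma gam_neq0 (r i n : nat) : (i < r)%N -> (0 < n <= i)%N -> gam r i%:Z n%:Z != 0.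
Proof.
move=> ir ni; have r1 : (0 < 1 < r)%N by lia.
rewrite /gam /qint; have -> : i%:Z - n%:Z + 1 = (i - n + 1)%N%:Z :> int by lia.
by rewrite !mulf_neq0 ?invr_eq0 ?qbr_neq0 //; lia.
Qed.

(** The action of [F] on R is given by steps counted from the bottom of the string, whereas [bv]
    counts from the top; this symmetry translates one into the other. *)
Lemma gam_sym (r i n : nat) : (n <= i)%N -> gam r i%:Z (i - n)%N%:Z = gam r i%:Z n.+1%:Z.
Proof.
move=> ni; rewrite /gam mulrC; congr (qint _ _ * qint _ _); lia.
Qed.

(** The scalar by which K^{-1} acts on C^H_{kr}, hence the factor that [F] carries in degree k. *)
Definition degsign (r : nat) (k : int) : CC := qpow r (- (k * r%:Z)).

Lemma degsignE (r : nat) (k : int) : (0 < r)%N -> degsign r k = (-1) ^ k.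
Proof.
move=> r0; rewrite /degsign /qpow -mulNr mulrC -exprz_exp.
rewrite -[qC r ^ r]/(qC r ^+ r) qC_exp_r // -exprz_inv.
by rewrite invrN invr1.
Qed.

Lemma degsign_neq0 (r : nat) (k : int) : (0 < r)%N -> degsign r k != 0.
Proof. by move=> r0; rewrite degsignE // expfz_neq0 // oppr_eq0 oner_eq0. Qed.

Lemma degsignS (r : nat) (k : int) : (0 < r)%N -> degsign r (k + 1) = - degsign r k.
Proof.
by move=> r0; rewrite !degsignE // expfzDr ?oppr_eq0 ?oner_eq0 // expr1z mulrN1.
Qed.

Lemma degsignP (r : nat) (k : int) : (0 < r)%N -> degsign r (k - 1) = - degsign r k.
Proof. by move=> r0; rewrite -{2}(subrK 1 k) degsignS // opprK. Qed.

(** * The basis and the action of E and F *)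

(** The j in the definition of P_i; an involution of the indices 0, ..., r-2. *)
Definition mirror (r i : nat) : nat := (r - 2 - i)%N.

Definition weight_in (r i t n : nat) : int :=
  match t with
  | 0 | 1 => i%:Z - 2 * n%:Z
  | 2 => r%:Z + (mirror r i)%:Z - 2 * n%:Z
  | _ => (mirror r i)%:Z - r%:Z - 2 * n%:Z
  end.

(* Basis vectors indexed by the number [n] of steps below the top of their string
   ([h], [s], [R] or [L]), so that homomorphisms preserve [n]. *)
Definition bv (r : nat) (k : int) (i t n : nat) : B0 := (k, i, t, weight_in r i t n).

Definition valid_idx (r i t n : nat) : bool :=
  if (i.+2 <= r)%N then (t < 4)%N && (n <= if (t < 2)%N then i else mirror r i)%N
  else [&& i.+1 == r, t == 0%N & (n <= i)%N].

Lemma validb_bv r k i t n : validb r (bv r k i t n) = valid_idx r i t n.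
Proof.
rewrite /valid_idx /bv /validb /weight_in /mirror.
case: ifP => hi; last by case: ifP => // hr; case: t => [|t] //=; lia.
by case: t => [|[|[|[|t]]]] //=; lia.
Qed.

Lemma validP r (b : B0) : validb r b ->
  exists k i t n, b = bv r k i t n /\ valid_idx r i t n.
Proof.
move=> hb; move: (hb); case: b hb => [[[k i] t] m] hb.
suff [n hn] : exists n, m = weight_in r i t n.
  by move=> hv; exists k, i, t, n; rewrite -(validb_bv r k) /bv -hn.
move: hb; rewrite /validb /weight_in /mirror.
case: ifP => hi.
  case: t => [|[|[|[|t]]]] //= h.
  - exists (`|(i%:Z - m) %/ 2|%Z)%N; lia.
  - exists (`|(i%:Z - m) %/ 2|%Z)%N; lia.
  - exists (`|(r%:Z + (r - 2 - i)%N%:Z - m) %/ 2|%Z)%N; lia.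
  - exists (`|((r - 2 - i)%N%:Z - r%:Z - m) %/ 2|%Z)%N; lia.
case: ifP => // hr; case: t => [|t] //= h.
exists (`|(i%:Z - m) %/ 2|%Z)%N; lia.
Qed.

Lemma bv_eq r k i t n k' i' t' n' :
  (bv r k i t n == bv r k' i' t' n') = [&& k == k', i == i', t == t' & n == n'].
Proof.
rewrite /bv !xpair_eqE; case: eqP => //= _; case: eqP => //= ->; case: eqP => //= ->.
by rewrite /weight_in; case: t' => [|[|[|t']]]; lia.
Qed.

(** This and the following rules restate the action in step counts. Strings are linked at their
    ends: [E] leads from the top of h to the bottom of R and from the top of L to the bottom of s,
    [F] from the bottom of h to the top of L and from the bottom of R to the top of s. *)
Lemma Eimg_h0 r k i : (i.+2 <= r)%N ->
  Eimg r (bv r k i 0 0) = [:: (1, bv r k i 2 (mirror r i))].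
Proof.
move=> hi; rewrite /Eimg validb_bv /valid_idx hi /= hi.
rewrite /bv /weight_in subr0 eqxx; congr [:: (_, (_, _, _, _))]; rewrite /mirror; lia.
Qed.

Lemma Eimg_hS r k i n : (i.+2 <= r)%N -> (n < i)%N ->
  Eimg r (bv r k i 0 n.+1) =
    [:: (gam r i n.+1, bv r k i 0 n); (1, bv r k i 1 n)].
Proof.
move=> hi hn; rewrite /Eimg validb_bv /valid_idx hi /= hi hn /=.
rewrite /bv /weight_in ifF; last lia.
have -> : ((i%:Z - (i%:Z - 2 * n.+1%:Z)) %/ 2)%Z = n.+1 by lia.
by congr [:: (_, (_, _, _, _)); (_, (_, _, _, _))]; lia.
Qed.

Lemma Eimg_s0 r k i : (i.+2 <= r)%N -> Eimg r (bv r k i 1 0) = [::].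
Proof.
by move=> hi; rewrite /Eimg validb_bv /valid_idx hi /= hi /bv /weight_in subr0 eqxx.
Qed.

Lemma Eimg_sS r k i n : (i.+2 <= r)%N -> (n < i)%N ->
  Eimg r (bv r k i 1 n.+1) = [:: (gam r i n.+1, bv r k i 1 n)].
Proof.
move=> hi hn; rewrite /Eimg validb_bv /valid_idx hi /= hi hn /=.
rewrite /bv /weight_in ifF; last lia.
have -> : ((i%:Z - (i%:Z - 2 * n.+1%:Z)) %/ 2)%Z = n.+1 by lia.
by congr [:: (_, (_, _, _, _))]; lia.
Qed.

Lemma Eimg_R0 r k i : (i.+2 <= r)%N -> Eimg r (bv r k i 2 0) = [::].
Proof.
move=> hi; rewrite /Eimg validb_bv /valid_idx hi /= hi /bv /weight_in ifF //.
rewrite /mirror; lia.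
Qed.

Lemma Eimg_RS r k i n : (i.+2 <= r)%N -> (n < mirror r i)%N ->
  Eimg r (bv r k i 2 n.+1) = [:: (1, bv r k i 2 n)].
Proof.
move=> hi hn; rewrite /Eimg validb_bv /valid_idx hi /= hi hn /=.
rewrite /bv /weight_in ifT; last by rewrite /mirror; lia.
by congr [:: (_, (_, _, _, _))]; lia.
Qed.

Lemma Eimg_L0 r k i : (i.+2 <= r)%N ->
  Eimg r (bv r k i 3 0) = [:: (1, bv r k i 1 i)].
Proof.
move=> hi; rewrite /Eimg validb_bv /valid_idx hi /= hi /bv /weight_in subr0 eqxx.
by congr [:: (_, (_, _, _, _))]; lia.
Qed.

Lemma Eimg_LS r k i n : (i.+2 <= r)%N -> (n < mirror r i)%N ->
  Eimg r (bv r k i 3 n.+1) = [:: (- gam r (mirror r i) n.+1, bv r k i 3 n)].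
Proof.
move=> hi hn; rewrite /Eimg validb_bv /valid_idx hi /= hi hn /=.
rewrite /bv /weight_in ifF; last by rewrite /mirror; lia.
rewrite -/(mirror r i).
have -> : (((mirror r i)%:Z - r%:Z - ((mirror r i)%:Z - r%:Z - 2 * n.+1%:Z)) %/ 2)%Z = n.+1 by lia.
by congr [:: (_, (_, _, _, _))]; lia.
Qed.

Lemma Eimg_v0 r k i : i.+1 = r -> Eimg r (bv r k i 0 0) = [::].
Proof.
move=> hi; rewrite /Eimg validb_bv /valid_idx -hi ltnn eqxx /=.
by rewrite ltnn /bv /weight_in subr0 eqxx.
Qed.

Lemma Eimg_vS r k i n : i.+1 = r -> (n < i)%N ->
  Eimg r (bv r k i 0 n.+1) = [:: (gam r i n.+1, bv r k i 0 n)].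
Proof.
move=> hi hn; rewrite /Eimg validb_bv /valid_idx -hi ltnn eqxx hn /= ltnn.
rewrite /bv /weight_in ifF; last lia.
have -> : ((i%:Z - (i%:Z - 2 * n.+1%:Z)) %/ 2)%Z = n.+1 by lia.
by congr [:: (_, (_, _, _, _))]; lia.
Qed.

Lemma Fimg_h r k i n : (i.+2 <= r)%N -> (n < i)%N ->
  Fimg r (bv r k i 0 n) = [:: (degsign r k, bv r k i 0 n.+1)].
Proof.
move=> hi hn; rewrite /Fimg /Fimg0 validb_bv /valid_idx hi /= hi (ltnW hn) /=.
rewrite /bv /weight_in ifT; last lia.
by rewrite /= mulr1; congr [:: (_, (_, _, _, _))]; lia.
Qed.

Lemma Fimg_hi r k i : (i.+2 <= r)%N ->
  Fimg r (bv r k i 0 i) = [:: (degsign r k, bv r k i 3 0)].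
Proof.
move=> hi; rewrite /Fimg /Fimg0 validb_bv /valid_idx hi /= hi leqnn /=.
rewrite /bv /weight_in ifF; last lia.
by rewrite /= mulr1; congr [:: (_, (_, _, _, _))]; rewrite /mirror; lia.
Qed.

Lemma Fimg_s r k i n : (i.+2 <= r)%N -> (n < i)%N ->
  Fimg r (bv r k i 1 n) = [:: (degsign r k, bv r k i 1 n.+1)].
Proof.
move=> hi hn; rewrite /Fimg /Fimg0 validb_bv /valid_idx hi /= hi (ltnW hn) /=.
rewrite /bv /weight_in ifT; last lia.
by rewrite /= mulr1; congr [:: (_, (_, _, _, _))]; lia.
Qed.

Lemma Fimg_si r k i : (i.+2 <= r)%N -> Fimg r (bv r k i 1 i) = [::].
Proof.
move=> hi; rewrite /Fimg /Fimg0 validb_bv /valid_idx hi /= hi leqnn /=.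
by rewrite /bv /weight_in ifF //; lia.
Qed.

Lemma Fimg_R r k i n : (i.+2 <= r)%N -> (n < mirror r i)%N ->
  Fimg r (bv r k i 2 n) = [:: (degsign r k * - gam r (mirror r i) n.+1, bv r k i 2 n.+1)].
Proof.
move=> hi hn; rewrite /Fimg /Fimg0 validb_bv /valid_idx hi /= hi (ltnW hn) /=.
rewrite /bv /weight_in ifF; last by move: hn; rewrite /mirror; lia.
rewrite -gam_sym; last exact: ltnW.
have -> : ((r%:Z + (mirror r i)%:Z - 2 * n%:Z - (r - (r - 2 - i))%N%:Z) %/ 2)%Z
   = (mirror r i - n)%N by move: hn; rewrite /mirror; lia.
by rewrite /=; congr [:: (_, (_, _, _, _))]; lia.
Qed.

Lemma Fimg_Rj r k i : (i.+2 <= r)%N ->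
  Fimg r (bv r k i 2 (mirror r i)) = [:: (degsign r k, bv r k i 1 0)].
Proof.
move=> hi; rewrite /Fimg /Fimg0 validb_bv /valid_idx hi /= hi leqnn /=.
rewrite /bv /weight_in ifT; last by rewrite /mirror; lia.
by rewrite /= mulr1; congr [:: (_, (_, _, _, _))]; lia.
Qed.

Lemma Fimg_L r k i n : (i.+2 <= r)%N -> (n < mirror r i)%N ->
  Fimg r (bv r k i 3 n) = [:: (degsign r k, bv r k i 3 n.+1)].
Proof.
move=> hi hn; rewrite /Fimg /Fimg0 validb_bv /valid_idx hi /= hi (ltnW hn) /=.
rewrite /bv /weight_in ifT; last by move: hn; rewrite /mirror; lia.
by rewrite /= mulr1; congr [:: (_, (_, _, _, _))]; lia.
Qed.

Lemma Fimg_Lj r k i : (i.+2 <= r)%N -> Fimg r (bv r k i 3 (mirror r i)) = [::].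
Proof.
move=> hi; rewrite /Fimg /Fimg0 validb_bv /valid_idx hi /= hi leqnn /=.
by rewrite /bv /weight_in ifF // /mirror; lia.
Qed.

Lemma Fimg_v r k i n : i.+1 = r -> (n < i)%N ->
  Fimg r (bv r k i 0 n) = [:: (degsign r k, bv r k i 0 n.+1)].
Proof.
move=> hi hn; rewrite /Fimg /Fimg0 validb_bv /valid_idx -hi ltnn eqxx (ltnW hn) /= ltnn.
rewrite /bv /weight_in ifT; last lia.
by rewrite /= mulr1; congr [:: (_, (_, _, _, _))]; lia.
Qed.

Lemma Fimg_vi r k i : i.+1 = r -> Fimg r (bv r k i 0 i) = [::].
Proof.
move=> hi; rewrite /Fimg /Fimg0 validb_bv /valid_idx -hi ltnn eqxx leqnn /= ltnn.
by rewrite /bv /weight_in ifF //; lia.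
Qed.

Arguments wt : simpl never.
Arguments bv : simpl never.
Arguments weight_in : simpl never.

(** Common form of [Ecoef], [Fcoef] and the later [endo], so that one summation lemma serves all
    three. *)
Definition lincoef (l : seq (CC * B0)) (d : B0) : CC :=
  \sum_(p <- l) (if p.2 == d then p.1 else 0).

Lemma lincoef_nil d : lincoef [::] d = 0.
Proof. exact: big_nil. Qed.

Lemma lincoef_cons x l d : lincoef (x :: l) d = x.1 * (x.2 == d)%:R + lincoef l d.
Proof. by rewrite /lincoef big_cons; case: eqP; rewrite ?mulr1 ?mulr0. Qed.

Lemma EcoefE r b d : Ecoef r b d = lincoef (Eimg r b) d.
Proof. by []. Qed.

Lemma FcoefE r b d : Fcoef r b d = lincoef (Fimg r b) d.
Proof. by []. Qed.

Lemma bv_ind r (P : B0 -> Prop) :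
  (forall k i n, (i.+2 <= r)%N -> (n <= i)%N -> P (bv r k i 0 n)) ->
  (forall k i n, (i.+2 <= r)%N -> (n <= i)%N -> P (bv r k i 1 n)) ->
  (forall k i n, (i.+2 <= r)%N -> (n <= mirror r i)%N -> P (bv r k i 2 n)) ->
  (forall k i n, (i.+2 <= r)%N -> (n <= mirror r i)%N -> P (bv r k i 3 n)) ->
  (forall k i n, i.+1 = r -> (n <= i)%N -> P (bv r k i 0 n)) ->
  forall b, validb r b -> P b.
Proof.
move=> h0 h1 h2 h3 hv b /validP[k [i [t [n [-> ]]]]].
rewrite /valid_idx; case: ifP => hi; last by case/and3P=> /eqP hr /eqP -> hn; apply: hv.
case: t => [|[|[|[|t]]]] //= hn; auto.
Qed.

Lemma wt_bv r k i t n : wt r (bv r k i t n) = k * r%:Z + weight_in r i t n.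
Proof. by []. Qed.

Lemma weight_in_bound r i t n : valid_idx r i t n -> `|weight_in r i t n| < 2 * r%:Z.
Proof.
rewrite /valid_idx /weight_in /mirror; case: ifP => hi.
  by case: t => [|[|[|[|t]]]] //= hn; lia.
by case/and3P=> /eqP hr /eqP -> hn; lia.
Qed.

Lemma valid_idx_ltr r i t n : valid_idx r i t n -> (i < r)%N.
Proof. by rewrite /valid_idx; case: ifP => [hi _|_ /and3P[/eqP <-]] //; apply: ltnW. Qed.

(** Weights inside P_i lie strictly between -2r and 2r, so the degree of a vector of weight w is
    within 3 of the quotient of w by r. The seven degrees searched by [wlist] thus miss nothing, and
    a sum over [wlist] is a sum over the whole weight space. *)
Lemma mem_wlist r w (b : B0) : (b \in wlist r w) = validb r b && (wt r b == w).
Proof.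
rewrite /wlist mem_filter; case hv: (validb r b); rewrite ?andTb ?andFb //.
have [k [i [t [n [hb hok]]]]] := validP hv; subst b.
have hw := weight_in_bound hok; rewrite wt_bv.
have ir := valid_idx_ltr hok; have r0 : (0 < r)%N by lia.
have t4 : (t < 4)%N.
  by move: hok; rewrite /valid_idx; case: ifP => _; [case/andP | case/and3P => _ /eqP->].
apply/idP/eqP => [/allpairsPdep[k' [[i' t'] /= [_ _]]]|hE].
  by rewrite /bv => -[-> _ _ ->]; lia.
apply/allpairsPdep; exists k, (i, t); split.
- apply/mapP; exists (absz (k - ((w %/ r%:Z)%Z - 3))%R); last first.
    suff : (w %/ r%:Z)%Z - 3 <= k by lia.
    have := divz_eq w r; have := ltz_pmod w (d := r%:Z) ltac:(lia).
    have := modz_ge0 w (d := r%:Z) ltac:(lia).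
    move: (w %/ r%:Z)%Z (w %% r%:Z)%Z hE hw => a m; nia.
  rewrite mem_iota.
  suff : -3 < k - (w %/ r%:Z)%Z < 4 by lia.
  have := divz_eq w r; have := ltz_pmod w (d := r%:Z) ltac:(lia).
  have := modz_ge0 w (d := r%:Z) ltac:(lia).
  move: (w %/ r%:Z)%Z (w %% r%:Z)%Z hE hw => a m *; apply/andP; split; nia.
- by apply/allpairsPdep; exists i, t; rewrite !mem_iota ir t4.
- by rewrite /bv -hE addrC addKr.
Qed.

Lemma wlist_uniq r w : uniq (wlist r w).
Proof.
rewrite filter_uniq // allpairs_uniq //.
- by rewrite map_inj_uniq ?iota_uniq // => x y /addrI; case.
- by rewrite allpairs_uniq ?iota_uniq // => -[? ?] [? ?] _ _ /= [-> ->].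
- by move=> [? [? ?]] [? [? ?]] _ _ /= [-> -> ->].
Qed.

Lemma sum_delta r w (c : B0) (g : B0 -> CC) : c \in wlist r w ->
  \sum_(x <- wlist r w) (x == c)%:R * g x = g c.
Proof.
move=> hc; rewrite (bigD1_seq c) ?wlist_uniq //= eqxx mul1r big1 ?addr0 //.
by move=> x /negPf ->; rewrite mul0r.
Qed.

(** Collapses a matrix product with a sparse left factor to its few listed terms; the hypothesis
    keeps any term from falling outside the weight space. *)
Lemma sum_lincoef r w (l : seq (CC * B0)) (g : B0 -> CC) :
  all (fun p => p.2 \in wlist r w) l ->
  \sum_(c <- wlist r w) lincoef l c * g c = \sum_(p <- l) p.1 * g p.2.
Proof.
elim: l => [|x l IH] /=; first by rewrite big_nil big1 // => c _; rewrite lincoef_nil mul0r.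
case/andP=> hx hl; rewrite big_cons -IH // -(sum_delta g hx) mulr_sumr -big_split /=.
by apply: eq_bigr => c _; rewrite lincoef_cons eq_sym; ring.
Qed.

Lemma inw_bv r w k i t n :
  (bv r k i t n \in wlist r w) = valid_idx r i t n && (k * r%:Z + weight_in r i t n == w).
Proof. by rewrite mem_wlist validb_bv wt_bv. Qed.

Lemma mirror_ltr r i : (i.+2 <= r)%N -> ((mirror r i).+2 <= r)%N.
Proof. rewrite /mirror; lia. Qed.

Lemma mirrorK r i : (i.+2 <= r)%N -> mirror r (mirror r i) = i.
Proof. rewrite /mirror; lia. Qed.

Lemma valid_idx_h r i n : (i.+2 <= r)%N -> valid_idx r i 0 n = (n <= i)%N.
Proof. by rewrite /valid_idx => ->. Qed.
Lemma valid_idx_s r i n : (i.+2 <= r)%N -> valid_idx r i 1 n = (n <= i)%N.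
Proof. by rewrite /valid_idx => ->. Qed.
Lemma valid_idx_R r i n : (i.+2 <= r)%N -> valid_idx r i 2 n = (n <= mirror r i)%N.
Proof. by rewrite /valid_idx => ->. Qed.
Lemma valid_idx_L r i n : (i.+2 <= r)%N -> valid_idx r i 3 n = (n <= mirror r i)%N.
Proof. by rewrite /valid_idx => ->. Qed.
Lemma valid_idx_v r i n : i.+1 = r -> valid_idx r i 0 n = (n <= i)%N.
Proof. by rewrite /valid_idx => <-; rewrite ltnn eqxx. Qed.

Lemma Eimg_invalid r b : ~~ validb r b -> Eimg r b = [::].
Proof. by rewrite /Eimg => ->. Qed.
Lemma Fimg_invalid r b : ~~ validb r b -> Fimg r b = [::].
Proof. by case: b => [[[k i] t] m]; rewrite /Fimg /Fimg0 => ->. Qed.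

Lemma Eimg_mem r b : all (fun p => p.2 \in wlist r (wt r b + 2)) (Eimg r b).
Proof.
have [hv|/Eimg_invalid->] := boolP (validb r b); last by [].
move: b hv; apply: bv_ind => k i [|n] hi hn.
- by rewrite Eimg_h0 //= inw_bv valid_idx_R // leqnn wt_bv /weight_in /mirror; lia.
- by rewrite Eimg_hS //= !inw_bv valid_idx_h // valid_idx_s // wt_bv /weight_in; lia.
- by rewrite Eimg_s0.
- by rewrite Eimg_sS //= inw_bv valid_idx_s // wt_bv /weight_in; lia.
- by rewrite Eimg_R0.
- by rewrite Eimg_RS //= inw_bv valid_idx_R // wt_bv /weight_in; lia.
- by rewrite Eimg_L0 //= inw_bv valid_idx_s // leqnn wt_bv /weight_in /mirror; lia.
- by rewrite Eimg_LS //= inw_bv valid_idx_L // wt_bv /weight_in; lia.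
- by rewrite Eimg_v0.
- by rewrite Eimg_vS //= inw_bv valid_idx_v // wt_bv /weight_in; lia.
Qed.

Lemma Fimg_mem r b : all (fun p => p.2 \in wlist r (wt r b - 2)) (Fimg r b).
Proof.
have [hv|/Fimg_invalid->] := boolP (validb r b); last by [].
move: b hv; apply: bv_ind => k i n hi; rewrite leq_eqVlt => /orP[/eqP->|hn].
- by rewrite Fimg_hi //= inw_bv valid_idx_L // wt_bv /weight_in /mirror; lia.
- by rewrite Fimg_h //= inw_bv valid_idx_h // wt_bv /weight_in; lia.
- by rewrite Fimg_si.
- by rewrite Fimg_s //= inw_bv valid_idx_s // wt_bv /weight_in; lia.
- by rewrite Fimg_Rj //= inw_bv valid_idx_s // wt_bv /weight_in /mirror; lia.
- by rewrite Fimg_R //= inw_bv valid_idx_R // wt_bv /weight_in; lia.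
- by rewrite Fimg_Lj.
- by rewrite Fimg_L //= inw_bv valid_idx_L // wt_bv /weight_in; lia.
- by rewrite Fimg_vi.
- by rewrite Fimg_v //= inw_bv valid_idx_v // wt_bv /weight_in; lia.
Qed.

(** * Endomorphisms as matrices *)

Section Commutation.
Variable r : nat.

(** Here X is thought of as raising weights by s and f as preserving them, which fixes the weight of
    the intermediate vectors on each side. *)
Definition commutes (f X : Mat) (s : int) : Prop :=
  forall b d, \sum_(c <- wlist r (wt r b)) f b c * X c d =
              \sum_(c <- wlist r (wt r b + s)) X b c * f c d.

Lemma exchange_mul (w w' : int) (u : B0 -> CC) (X : Mat) (v : B0 -> CC) :
  \sum_(c <- wlist r w) u c * (\sum_(e <- wlist r w') X c e * v e) =
  \sum_(e <- wlist r w') (\sum_(c <- wlist r w) u c * X c e) * v e.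
Proof.
under eq_bigr do rewrite mulr_sumr.
rewrite exchange_big; apply: eq_bigr => e _; rewrite mulr_suml.
by apply: eq_bigr => c _; rewrite mulrA.
Qed.

Lemma eq_wlist (w : int) (F G : B0 -> CC) :
  (forall c, wt r c = w -> F c = G c) ->
  \sum_(c <- wlist r w) F c = \sum_(c <- wlist r w) G c.
Proof.
by move=> h; apply: eq_big_seq => c; rewrite mem_wlist => /andP[_ /eqP/h].
Qed.

Lemma commutes_mul (f g X : Mat) (s : int) :
  commutes f X s -> commutes g X s ->
  commutes (fun b d => \sum_(c <- wlist r (wt r b)) g b c * f c d) X s.
Proof.
move=> hf hg b d.
rewrite -exchange_mul.
under eq_wlist => c hc do rewrite -hc hf hc.
rewrite exchange_mul; under eq_bigr do rewrite hg.
rewrite -exchange_mul; apply: eq_wlist => c hc.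
by rewrite hc.
Qed.

Lemma commutes_comp (f X Y : Mat) (s t : int) :
  commutes f X s -> commutes f Y t ->
  commutes f (fun b d => \sum_(c <- wlist r (wt r b + s)) X b c * Y c d) (s + t).
Proof.
move=> hX hY b d.
under eq_wlist => c hc do rewrite hc.
rewrite exchange_mul; under eq_bigr do rewrite hX.
rewrite -!exchange_mul; apply: eq_wlist => c hc.
by rewrite -{1}hc hY hc addrA.
Qed.

End Commutation.

(** * The action of sigma on the basis *)

Definition sigma_step (r : nat) : int := ((2 * rprime r) %/ r)%N%:Z.

Definition kshift (z : int) (b : B0) : B0 :=
  let '(k, i, t, m) := b in (k + z, i, t, m).

Lemma sigma_kshift r b : sigma_shift r b = kshift (sigma_step r) b.
Proof. by case: b => [[[k i] t] m]. Qed.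

Lemma kshift_bv r z k i t n : kshift z (bv r k i t n) = bv r (k + z) i t n.
Proof. by []. Qed.

Lemma kshiftK z : cancel (kshift z) (kshift (- z)).
Proof. by case=> [[[k i] t] m] /=; rewrite addrK. Qed.

Lemma kshift_inj z : injective (kshift z).
Proof. exact: can_inj (kshiftK z). Qed.

Lemma validb_kshift r z b : validb r (kshift z b) = validb r b.
Proof. by case: b => [[[k i] t] m]. Qed.

Lemma wt_kshift r z b : wt r (kshift z b) = wt r b + z * r%:Z.
Proof. by case: b => [[[k i] t] m]; rewrite /wt /=; lia. Qed.

Lemma sigma_step_odd r : odd r -> sigma_step r = 2.
Proof. by move=> h; rewrite /sigma_step /rprime h mulnK //; case: r h. Qed.

Lemma sigma_step_even r : ~~ odd r -> (0 < r)%N -> sigma_step r = 1.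
Proof.
move=> /negPf h r0; rewrite /sigma_step /rprime h mulnC.
by rewrite divnK ?divnn ?r0 // dvdn2 h.
Qed.

Lemma inP_sigma r nu b : inP r nu (sigma_shift r b) = inP r nu b.
Proof.
rewrite sigma_kshift /inP validb_kshift.
case hv: (validb r b) => //=; rewrite wt_kshift.
have r0 : (0 < r)%N.
  by have [k [i [t [n [_ h]]]]] := validP hv; have := valid_idx_ltr h; lia.
have [ho|ho] := boolP (odd r); first by rewrite sigma_step_odd //; lia.
by rewrite sigma_step_even //; lia.
Qed.

Lemma wlist_kshift r z w :
  perm_eq (wlist r (w + z * r%:Z)) (map (kshift z) (wlist r w)).
Proof.
apply: uniq_perm; rewrite ?wlist_uniq ?map_inj_uniq ?wlist_uniq //; first exact: kshift_inj.
move=> c; have -> : c = kshift z (kshift (- z) c).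
  by have := kshiftK (- z) c; rewrite opprK.
rewrite mem_map; last exact: kshift_inj.
rewrite !mem_wlist validb_kshift wt_kshift (inj_eq (addIr _)) //.
Qed.

Section Endomorphisms.
Variables (r : nat) (nu : bool).
Implicit Types f g : Mat.

Lemma inEnd_comE f : inEnd r nu f -> commutes r f (Ecoef r) 2.
Proof. by case. Qed.

Lemma inEnd_comF f : inEnd r nu f -> commutes r f (Fcoef r) (- 2).
Proof. by case. Qed.

Lemma inEnd_wt f b c : inEnd r nu f -> wt r b != wt r c -> f b c = 0.
Proof.
case=> _ [hH _] _ _ _ hw; have /eqP := hH b c.
rewrite [X in _ == X]mulrC -subr_eq0 -mulrBl mulf_eq0 => /orP[|/eqP//].
rewrite subr_eq0 (inj_eq (intr_inj (R := complex Rdefinitions.R))).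
by rewrite eq_sym (negPf hw).
Qed.

(** [H] and [K] act on a vector by scalars that depend only on its weight, so preserving weights
    gives both commutations at once. *)
Lemma inEndI f :
  (forall b c, ~~ (inP r nu b && inP r nu c) -> f b c = 0) ->
  (forall b c, wt r b != wt r c -> f b c = 0) ->
  commutes r f (Ecoef r) 2 -> commutes r f (Fcoef r) (- 2) ->
  (forall b c, f (sigma_shift r b) (sigma_shift r c) = f b c) ->
  inEnd r nu f.
Proof.
move=> h1 hw h3 h4 h5; split=> //.
by split=> b c; have [->|/hw->] := eqVneq (wt r b) (wt r c);
  rewrite ?mulr0 ?mul0r // mulrC.
Qed.

Lemma inEnd_add f g : inEnd r nu f -> inEnd r nu g ->
  inEnd r nu (fun b c => f b c + g b c).
Proof.
move=> hf hg; have [f1 _ f3 f4 f5] := hf; have [g1 _ g3 g4 g5] := hg.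
apply: inEndI => [b c h|b c h|b d|b d|b c].
- by rewrite f1 // g1 // addr0.
- by rewrite (inEnd_wt hf) // (inEnd_wt hg) // addr0.
- under eq_bigr do rewrite mulrDl.
  under [RHS]eq_bigr do rewrite mulrDr.
  by rewrite !big_split /= f3 g3.
- under eq_bigr do rewrite mulrDl.
  under [RHS]eq_bigr do rewrite mulrDr.
  by rewrite !big_split /= f4 g4.
- by rewrite f5 g5.
Qed.

Lemma inEnd_scl a f : inEnd r nu f -> inEnd r nu (fun b c => a * f b c).
Proof.
move=> hf; have [f1 _ f3 f4 f5] := hf.
apply: inEndI => [b c h|b c h|b d|b d|b c].
- by rewrite f1 // mulr0.
- by rewrite (inEnd_wt hf) // mulr0.
- under eq_bigr do rewrite -mulrA.
  under [RHS]eq_bigr do rewrite mulrCA.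
  by rewrite -!mulr_sumr f3.
- under eq_bigr do rewrite -mulrA.
  under [RHS]eq_bigr do rewrite mulrCA.
  by rewrite -!mulr_sumr f4.
- by rewrite f5.
Qed.

Lemma inEnd_mul f g : inEnd r nu f -> inEnd r nu g ->
  inEnd r nu (fun b d => \sum_(c <- wlist r (wt r b)) g b c * f c d).
Proof.
move=> hf hg; have [f1 _ f3 f4 f5] := hf; have [g1 _ g3 g4 g5] := hg.
apply: inEndI.
- move=> b d; rewrite negb_and => h; apply: big1 => c _.
  case/orP: h => h; first by rewrite g1 ?mul0r // negb_and h.
  by rewrite f1 ?mulr0 // negb_and h orbT.
- move=> b d h; rewrite big1_seq // => c /andP[_]; rewrite mem_wlist => /andP[_ /eqP hc].
  by rewrite (inEnd_wt (b := c) hf) ?mulr0 // hc.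
- exact: commutes_mul.
- exact: commutes_mul.
- move=> b d; rewrite {1}sigma_kshift wt_kshift (perm_big _ (wlist_kshift _ _ _)) /=.
  by rewrite big_map; apply: eq_bigr => c _; rewrite -!sigma_kshift f5 g5.
Qed.

Lemma com_rowE f b d : inEnd r nu f ->
  \sum_(c <- wlist r (wt r b)) f b c * Ecoef r c d = \sum_(p <- Eimg r b) p.1 * f p.2 d.
Proof. by move/inEnd_comE->; rewrite -(sum_lincoef (fun c => f c d) (Eimg_mem r b)). Qed.

Lemma com_rowF f b d : inEnd r nu f ->
  \sum_(c <- wlist r (wt r b)) f b c * Fcoef r c d = \sum_(p <- Fimg r b) p.1 * f p.2 d.
Proof. by move/inEnd_comF->; rewrite -(sum_lincoef (fun c => f c d) (Fimg_mem r b)). Qed.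

Definition roweq f g b := forall d, f b d = g b d.

Lemma roweqE f g b x c : inEnd r nu f -> inEnd r nu g ->
  Eimg r b = [:: (x, c)] -> x != 0 -> roweq f g b -> roweq f g c.
Proof.
move=> hf hg hb x0 h d; apply: (mulfI x0).
have := com_rowE b d hf; have := com_rowE b d hg; rewrite hb !big_seq1 /= => <- <-.
by apply: eq_bigr => e _; rewrite h.
Qed.

Lemma roweqF f g b x c : inEnd r nu f -> inEnd r nu g ->
  Fimg r b = [:: (x, c)] -> x != 0 -> roweq f g b -> roweq f g c.
Proof.
move=> hf hg hb x0 h d; apply: (mulfI x0).
have := com_rowF b d hf; have := com_rowF b d hg; rewrite hb !big_seq1 /= => <- <-.
by apply: eq_bigr => e _; rewrite h.
Qed.

(** Agreement spreads from h_i along single-term moves with nonzero coefficient: down h and on to L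
    by [F]; from h_i to the bottom of R and up by [E]; from the bottom of R to the top of s and down
    by [F]. *)
Lemma roweq_gen f g : inEnd r nu f -> inEnd r nu g ->
  (forall k i, (i < r)%N -> roweq f g (bv r k i 0 0)) -> f = g.
Proof.
move=> hf hg h0.
have one0 : (1 : CC) != 0 by exact: oner_neq0.
suff h : forall b, validb r b -> roweq f g b.
  apply: functional_extensionality => b; apply: functional_extensionality => c.
  case hb: (validb r b); first exact: h.
  have [hf1 _ _ _ _] := hf; have [hg1 _ _ _ _] := hg.
  by rewrite hf1 ?hg1 // negb_and /inP hb.
have hh k i n : (i.+2 <= r)%N -> (n <= i)%N -> roweq f g (bv r k i 0 n).
  move=> hi; elim: n => [|n IH] hn; first by apply: h0; lia.
  by apply: (roweqF hf hg (Fimg_h _ hi hn)); [apply: degsign_neq0; lia|apply: IH; lia].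
(* R is entered at its bottom, so the induction counts steps upwards. *)
have hR k i n : (i.+2 <= r)%N -> (n <= mirror r i)%N -> roweq f g (bv r k i 2 (mirror r i - n)).
  move=> hi; elim: n => [|n IH] hn.
    by rewrite subn0; apply: (roweqE hf hg (Eimg_h0 _ hi)) => //; apply: hh.
  have hn' : (mirror r i - n = (mirror r i - n.+1).+1)%N by lia.
  have := IH ltac:(lia); rewrite hn' => hR.
  by apply: (roweqE hf hg (Eimg_RS k (n := mirror r i - n.+1) hi _)) => //; lia.
apply: bv_ind => k i n hi.
- exact: hh.
- elim: n => [|n IH] hn.
    apply: (roweqF hf hg (Fimg_Rj _ hi)); first by apply: degsign_neq0; lia.
    by rewrite -(subn0 (mirror r i)); apply: hR.
  by apply: (roweqF hf hg (Fimg_s _ hi hn)); [apply: degsign_neq0; lia|apply: IH; lia].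
- by move=> hn; rewrite -(subKn hn); apply: hR => //; lia.
- elim: n => [|n IH] hn.
    by apply: (roweqF hf hg (Fimg_hi _ hi)); [apply: degsign_neq0; lia|apply: hh].
  by apply: (roweqF hf hg (Fimg_L _ hi hn)); [apply: degsign_neq0; lia|apply: IH; lia].
- elim: n => [|n IH] hn; first by apply: h0; lia.
  by apply: (roweqF hf hg (Fimg_v _ hi hn)); [apply: degsign_neq0; lia|apply: IH; lia].
Qed.

End Endomorphisms.

(** * Support of an endomorphism on top vectors *)

Definition FEcoef (r : nat) : Mat :=
  fun b d => \sum_(c <- wlist r (wt r b + 2)) Ecoef r b c * Fcoef r c d.

(** Generalized eigenvalue of [FE] n steps below the top of a string, with the sign [degsign] of the
    degree split off. *)
Definition FEeig (r i t n : nat) : CC :=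
  if (t < 2)%N then gam r i n else - gam r (mirror r i) n.

Arguments FEeig : simpl never.

Lemma FEcoefE r b d : FEcoef r b d = \sum_(p <- Eimg r b) p.1 * Fcoef r p.2 d.
Proof. by rewrite -(sum_lincoef (fun c => Fcoef r c d) (Eimg_mem r b)). Qed.

Lemma gam0 r i : gam r i 0 = 0.
Proof. by rewrite /gam /qint /qbr /qpow oppr0 subrr !mul0r. Qed.

Ltac rowsimp := rewrite ?big_cons ?big_nil ?lincoef_cons ?lincoef_nil /=.

(** A Jordan block on h and s. For n = 0 the s term arises by way of R, as E h_i is the bottom of R
    and [F] sends that to s_i; since gamma vanishes at 0, the formula is uniform in n. *)
Lemma FEcoef_h r k i n d : (i.+2 <= r)%N -> (n <= i)%N ->
  FEcoef r (bv r k i 0 n) d =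
  degsign r k * (FEeig r i 0 n * (bv r k i 0 n == d)%:R + (bv r k i 1 n == d)%:R).
Proof.
move=> hi; rewrite FEcoefE /FEeig; case: n => [|n] hn.
  by rewrite Eimg_h0 // !gam0; rowsimp; rewrite FcoefE Fimg_Rj //; rowsimp; ring.
rewrite Eimg_hS //; rowsimp; rewrite !FcoefE Fimg_h // Fimg_s //; rowsimp; ring.
Qed.

Lemma FEcoef_s r k i n d : (i.+2 <= r)%N -> (n <= i)%N ->
  FEcoef r (bv r k i 1 n) d = degsign r k * (FEeig r i 1 n * (bv r k i 1 n == d)%:R).
Proof.
move=> hi; rewrite FEcoefE /FEeig; case: n => [|n] hn.
  by rewrite Eimg_s0 // !gam0; rowsimp; ring.
rewrite Eimg_sS //; rowsimp; rewrite FcoefE Fimg_s //; rowsimp; ring.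
Qed.

Lemma FEcoef_R r k i n d : (i.+2 <= r)%N -> (n <= mirror r i)%N ->
  FEcoef r (bv r k i 2 n) d = degsign r k * (FEeig r i 2 n * (bv r k i 2 n == d)%:R).
Proof.
move=> hi; rewrite FEcoefE /FEeig; case: n => [|n] hn.
  by rewrite Eimg_R0 // !gam0; rowsimp; ring.
rewrite Eimg_RS //; rowsimp; rewrite FcoefE Fimg_R //; rowsimp; ring.
Qed.

Lemma FEcoef_L r k i n d : (i.+2 <= r)%N -> (n <= mirror r i)%N ->
  FEcoef r (bv r k i 3 n) d = degsign r k * (FEeig r i 3 n * (bv r k i 3 n == d)%:R).
Proof.
move=> hi; rewrite FEcoefE /FEeig; case: n => [|n] hn.
  by rewrite Eimg_L0 // !gam0; rowsimp; rewrite FcoefE Fimg_si //; rowsimp; ring.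
rewrite Eimg_LS //; rowsimp; rewrite FcoefE Fimg_L //; rowsimp; ring.
Qed.

Lemma FEcoef_v r k i n d : i.+1 = r -> (n <= i)%N ->
  FEcoef r (bv r k i 0 n) d = degsign r k * (FEeig r i 0 n * (bv r k i 0 n == d)%:R).
Proof.
move=> hi; rewrite FEcoefE /FEeig; case: n => [|n] hn.
  by rewrite Eimg_v0 // !gam0; rowsimp; ring.
rewrite Eimg_vS //; rowsimp; rewrite FcoefE Fimg_v //; rowsimp; ring.
Qed.

Lemma FEeig_neq0 r i t n : valid_idx r i t n.+1 -> FEeig r i t n.+1 != 0.
Proof.
move=> hok; have := valid_idx_ltr hok; move: hok; rewrite /valid_idx /FEeig.
case: ifP => hi; last by case/and3P=> _ /eqP -> hn hr; apply: gam_neq0.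
case/andP=> _; case: ifP => _ hn hr; first by apply: gam_neq0.
by rewrite oppr_eq0; apply: gam_neq0 => //; have := mirror_ltr hi; lia.
Qed.

(** The transposed table: a target is reached from itself and, if it is an s vector, also from the h
    vector at the same step. *)
Lemma FEcoef_col r c k i t n : validb r c -> valid_idx r i t n ->
  FEcoef r c (bv r k i t n) =
  (c == bv r k i t n)%:R * (degsign r k * FEeig r i t n) +
  (c == bv r k i 0 n)%:R * ((t == 1%N)%:R * degsign r k).
Proof.
move=> hc hok; move: c hc; apply: bv_ind => k' i' n' hi hn.
- rewrite FEcoef_h // !bv_eq; case: (k' =P k) => [->|_]; last by rewrite /=; ring.
  case: (i' =P i) => [<-|_]; last by rewrite /=; ring.
  by case: (n' =P n) => [<-|_]; case: t {hok} => [|[|t]]; rewrite /=; ring.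
- rewrite FEcoef_s // !bv_eq; case: (k' =P k) => [->|_]; last by rewrite /=; ring.
  case: (i' =P i) => [<-|_]; last by rewrite /=; ring.
  by case: (n' =P n) => [<-|_]; case: t {hok} => [|[|t]]; rewrite /=; ring.
- rewrite FEcoef_R // !bv_eq; case: (k' =P k) => [->|_]; last by rewrite /=; ring.
  case: (i' =P i) => [<-|_]; last by rewrite /=; ring.
  by case: (n' =P n) => [<-|_]; case: t {hok} => [|[|[|t]]]; rewrite /=; ring.
- rewrite FEcoef_L // !bv_eq; case: (k' =P k) => [->|_]; last by rewrite /=; ring.
  case: (i' =P i) => [<-|_]; last by rewrite /=; ring.
  by case: (n' =P n) => [<-|_]; case: t {hok} => [|[|[|[|t]]]]; rewrite /=; ring.
- rewrite FEcoef_v // !bv_eq; case: (k' =P k) => [->|_]; last by rewrite /=; ring.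
  case: (i' =P i) => [hii|_]; last by rewrite /=; ring.
  have -> : t = 0%N by subst i'; move: hok; rewrite /valid_idx hi ltnn => /and3P[_ /eqP].
  by subst i'; case: (n' =P n) => [<-|_]; rewrite /=; ring.
Qed.

Section Support.
Variables (r : nat) (nu : bool) (f : Mat).
Hypothesis hf : inEnd r nu f.

Lemma commutes_FE b d :
  \sum_(c <- wlist r (wt r b)) f b c * FEcoef r c d =
  \sum_(c <- wlist r (wt r b)) FEcoef r b c * f c d.
Proof.
have := commutes_comp (inEnd_comE hf) (inEnd_comF hf).
by rewrite subrr => /(_ b d) h; rewrite [LHS]h addr0.
Qed.

Lemma row_FE b k i t n : valid_idx r i t n -> wt r (bv r k i t n) = wt r b ->
  \sum_(c <- wlist r (wt r b)) f b c * FEcoef r c (bv r k i t n) =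
  degsign r k * (FEeig r i t n * f b (bv r k i t n) + (t == 1%N)%:R * f b (bv r k i 0 n)).
Proof.
move=> hok hw.
have hd : bv r k i t n \in wlist r (wt r b) by rewrite mem_wlist validb_bv hok hw eqxx.
have h0 : t = 1%N -> bv r k i 0 n \in wlist r (wt r b).
  move=> ht; rewrite mem_wlist validb_bv -hw ht !wt_bv eqxx andbT.
  move: hok; rewrite ht /valid_idx; case: ifP => // _; by case/and3P.
transitivity (\sum_(c <- wlist r (wt r b)) (c == bv r k i t n)%:R * (f b c * (degsign r k * FEeig r i t n))
  + \sum_(c <- wlist r (wt r b)) (c == bv r k i 0 n)%:R * (f b c * ((t == 1%N)%:R * degsign r k))).
  rewrite -big_split /=; apply: eq_big_seq => c; rewrite mem_wlist => /andP[hv _].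
  by rewrite FEcoef_col //; ring.
rewrite (sum_delta (fun c => f b c * (degsign r k * FEeig r i t n))) //.
case: eqP => [/h0 h|_].
  by rewrite (sum_delta (fun c => f b c * (true%:R * degsign r k))) //=; ring.
by rewrite big1 => [|c _] /=; ring.
Qed.

(* [FE] squares to zero on the top vector, while it is invertible away from the tops. *)
Lemma support_top k i d :
  (i < r)%N -> f (bv r k i 0 0) d != 0 ->
  exists k' i' t, [/\ d = bv r k' i' t 0, valid_idx r i' t 0 &
     wt r (bv r k i 0 0) = wt r (bv r k' i' t 0)].
Proof.
move=> hi hd.
have hv : validb r d.
  apply/negPn/negP => h; case: hf => h1 _ _ _ _; move/eqP: hd; apply.
  by rewrite h1 // /inP (negPf h) andbF.
have [k' [i' [t [n [hdd hok]]]]] := validP hv; subst d.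
have hw : wt r (bv r k i 0 0) = wt r (bv r k' i' t n).
  by apply/eqP/negPn/negP => h; move/eqP: hd; apply; apply: inEnd_wt hf h.
case: n hd hv hok hw => [|n] hd hv hok hw; first by exists k', i', t.
have r0 : (0 < r)%N by lia.
exfalso; move/eqP: hd; apply.
(* Up to the sign of degree k, [FE] sends the top vector to s_i, or to 0 in the simple module. Take
   u to be the image of that vector under f: then [hu1] says that [FE] maps f(h_i) to u up to sign,
   and [hu2] that [FE] kills u. *)
have [u hu1 hu2] : exists2 u : B0 -> CC,
    (forall k' i' t n, valid_idx r i' t n -> wt r (bv r k i 0 0) = wt r (bv r k' i' t n) ->
      degsign r k' * (FEeig r i' t n * f (bv r k i 0 0) (bv r k' i' t n)
        + (t == 1%N)%:R * f (bv r k i 0 0) (bv r k' i' 0 n)) = degsign r k * u (bv r k' i' t n)) &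
    (forall k' i' t n, valid_idx r i' t n -> wt r (bv r k i 0 0) = wt r (bv r k' i' t n) ->
      FEeig r i' t n * u (bv r k' i' t n) + (t == 1%N)%:R * u (bv r k' i' 0 n) = 0).
  have [hi2|hi2] := ltnP i.+1 r; last first.
    have hir : i.+1 = r by lia.
    exists (fun=> 0) => k1 i1 t1 n1 h1 h2; last by rewrite !mulr0 addr0.
    rewrite -row_FE // commutes_FE mulr0 big1 // => c _.
    by rewrite FEcoef_v // /FEeig !gam0 /=; ring.
  have hw1 : wt r (bv r k i 0 0) = wt r (bv r k i 1 0) by [].
  exists (f (bv r k i 1 0)) => k1 i1 t1 n1 h1 h2.
    rewrite -row_FE // commutes_FE.
    have hs : bv r k i 1 0 \in wlist r (wt r (bv r k i 0 0)).
      by rewrite mem_wlist validb_bv hw1 eqxx valid_idx_s.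
    rewrite -(sum_delta (fun c => degsign r k * f c (bv r k1 i1 t1 n1)) hs).
    apply: eq_bigr => c _; rewrite FEcoef_h // /FEeig !gam0 [c == _]eq_sym /=; ring.
  apply: (mulfI (degsign_neq0 k1 r0)); rewrite mulr0 -(row_FE (b := bv r k i 1 0) h1 (esym h2)) commutes_FE.
  by rewrite big1 // => c _; rewrite FEcoef_s // /FEeig !gam0 /=; ring.
(* In the h, R and L coordinates [FE] is diagonal with nonzero entries, so first u and then f
   vanishes there. The s coordinates also receive a term from h and are treated afterwards. *)
have vanish k1 i1 t1 n1 : valid_idx r i1 t1 n1.+1 ->
    wt r (bv r k i 0 0) = wt r (bv r k1 i1 t1 n1.+1) -> t1 != 1%N ->
    f (bv r k i 0 0) (bv r k1 i1 t1 n1.+1) = 0 /\ u (bv r k1 i1 t1 n1.+1) = 0.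
  move=> h1 h2 /negPf ht; have := hu1 _ _ _ _ h1 h2; have := hu2 _ _ _ _ h1 h2.
  rewrite ht !mul0r !addr0 => /eqP; rewrite mulf_eq0 (negPf (FEeig_neq0 h1)) /= => /eqP ->.
  rewrite mulr0 => /eqP; rewrite mulf_eq0 (negPf (degsign_neq0 _ r0)) mulf_eq0 (negPf (FEeig_neq0 h1)) /=.
  by move/eqP.
have [ht|ht] := eqVneq t 1%N; last by have [] := vanish _ _ _ _ hok hw ht.
subst t; have hok0 : valid_idx r i' 0 n.+1.
  by move: hok; rewrite /valid_idx; case: ifP => // _ /and3P[].
have [f0 u0] := vanish k' i' 0%N n hok0 hw isT.
have := hu1 _ _ _ _ hok hw; have := hu2 _ _ _ _ hok hw.
rewrite f0 u0 !mulr0 !addr0 => /eqP; rewrite mulf_eq0 (negPf (FEeig_neq0 hok)) /= => /eqP ->.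
rewrite mulr0 => /eqP; rewrite mulf_eq0 (negPf (degsign_neq0 _ r0)) mulf_eq0 (negPf (FEeig_neq0 hok)) /=.
by move/eqP.
Qed.

End Support.

Lemma divr_uniq (r a b x y : int) : 0 <= x < r -> 0 <= y < r ->
  a * r + x = b * r + y -> a = b /\ x = y.
Proof.
move=> hx hy h; have ab : a = b by nia.
by split=> //; rewrite ab in h; lia.
Qed.

(** Tops in P_{i'} have weights i', r + j' and j' - r with j' = r-2-i'. Comparison with kr + i by
    uniqueness of division with remainder gives i = i' in the same degree, or i = j' with the degree
    moved by one. *)
Lemma support_h0 r nu f k i d : inEnd r nu f -> (i.+2 <= r)%N ->
  f (bv r k i 0 0) d != 0 ->
  d \in [:: bv r k i 0 0; bv r k i 1 0; bv r (k + 1) (mirror r i) 3 0; bv r (k - 1) (mirror r i) 2 0].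
Proof.
move=> hf hi hd; have [|k' [i' [t [-> hok]]]] := support_top hf _ hd; first by lia.
rewrite !inE !bv_eq !wt_bv; have hi' := valid_idx_ltr hok; move: hok; rewrite /valid_idx.
case: ifP => hi2; last first.
  case/and3P=> /eqP hr /eqP -> _; rewrite /weight_in => h.
  have [|||hk hii] := @divr_uniq r%:Z k k' i%:Z i'%:Z; lia.
case: t => [|[|[|[|t]]]] //= _; rewrite /weight_in => h.
- have [|||hk hii] := @divr_uniq r%:Z k k' i%:Z i'%:Z; lia.
- have [|||hk hii] := @divr_uniq r%:Z k k' i%:Z i'%:Z; lia.
- have := mirror_ltr hi2; have := mirrorK hi2; move: h; set j := mirror r i' => h h1 h2.
  have [|||hk hii] := @divr_uniq r%:Z k (k' + 1) i%:Z j%:Z; try lia.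
  have -> : i = j by lia.
  by rewrite h1 !eqxx; lia.
- have := mirror_ltr hi2; have := mirrorK hi2; move: h; set j := mirror r i' => h h1 h2.
  have [|||hk hii] := @divr_uniq r%:Z k (k' - 1) i%:Z j%:Z; try lia.
  have -> : i = j by lia.
  by rewrite h1 !eqxx; lia.
Qed.

(** The remainder r-1 is attained only by the simple summand, since i' and r-2-i' are at most r-2
    otherwise. *)
Lemma support_v0 r nu f k i d : inEnd r nu f -> i.+1 = r ->
  f (bv r k i 0 0) d != 0 -> d = bv r k i 0 0.
Proof.
move=> hf hi hd; have [|k' [i' [t [-> hok]]]] := support_top hf _ hd; first by lia.
rewrite !wt_bv => h; apply/eqP; rewrite bv_eq.
move: h; have hi' := valid_idx_ltr hok; move: hok; rewrite /valid_idx.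
case: ifP => hi2; last first.
  case/and3P=> /eqP hr /eqP -> _; rewrite /weight_in => h.
  have [|||hk hii] := @divr_uniq r%:Z k k' i%:Z i'%:Z; lia.
case: t => [|[|[|[|t]]]] //= _; rewrite /weight_in => h.
- have [|||hk hii] := @divr_uniq r%:Z k k' i%:Z i'%:Z; lia.
- have [|||hk hii] := @divr_uniq r%:Z k k' i%:Z i'%:Z; lia.
- have := mirror_ltr hi2; have := mirrorK hi2; move: h; set j := mirror r i' => h h1 h2.
  have [|||hk hii] := @divr_uniq r%:Z k (k' + 1) i%:Z j%:Z; lia.
- have := mirror_ltr hi2; have := mirrorK hi2; move: h; set j := mirror r i' => h h1 h2.
  have [|||hk hii] := @divr_uniq r%:Z k (k' - 1) i%:Z j%:Z; lia.
Qed.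

Lemma inEnd_eq r nu f g : inEnd r nu f -> inEnd r nu g ->
  (forall k i, (i.+2 <= r)%N -> inP r nu (bv r k i 0 0) ->
    [/\ f (bv r k i 0 0) (bv r k i 0 0) = g (bv r k i 0 0) (bv r k i 0 0),
        f (bv r k i 0 0) (bv r k i 1 0) = g (bv r k i 0 0) (bv r k i 1 0),
        f (bv r k i 0 0) (bv r (k + 1) (mirror r i) 3 0) =
        g (bv r k i 0 0) (bv r (k + 1) (mirror r i) 3 0) &
        f (bv r k i 0 0) (bv r (k - 1) (mirror r i) 2 0) =
        g (bv r k i 0 0) (bv r (k - 1) (mirror r i) 2 0)]) ->
  (forall k i, i.+1 = r -> inP r nu (bv r k i 0 0) ->
    f (bv r k i 0 0) (bv r k i 0 0) = g (bv r k i 0 0) (bv r k i 0 0)) ->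
  f = g.
Proof.
move=> hf hg h2 h1; apply: (roweq_gen hf hg) => k i hi d.
have [hP|hP] := boolP (inP r nu (bv r k i 0 0)); last first.
  have [hf1 _ _ _ _] := hf; have [hg1 _ _ _ _] := hg.
  by rewrite hf1 ?hg1 // negb_and hP.
have [hi2|hi2] := ltnP i.+1 r.
  have [e1 e2 e3 e4] := h2 k i hi2 hP.
  have hd : f (bv r k i 0 0) d != 0 \/ g (bv r k i 0 0) d != 0 -> f (bv r k i 0 0) d = g (bv r k i 0 0) d.
    case=> [/(support_h0 hf hi2)|/(support_h0 hg hi2)];
    by rewrite !inE => /or4P[] /eqP->.
  have [f0|f0] := eqVneq (f (bv r k i 0 0) d) 0; last by apply: hd; left.
  have [g0|g0] := eqVneq (g (bv r k i 0 0) d) 0; last by apply: hd; right.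
  by rewrite f0 g0.
have hir : i.+1 = r by lia.
have e := h1 k i hir hP.
have hd : f (bv r k i 0 0) d != 0 \/ g (bv r k i 0 0) d != 0 -> f (bv r k i 0 0) d = g (bv r k i 0 0) d.
  by case=> [/(support_v0 hf hir)|/(support_v0 hg hir)] ->.
have [f0|f0] := eqVneq (f (bv r k i 0 0) d) 0; last by apply: hd; left.
have [g0|g0] := eqVneq (g (bv r k i 0 0) d) 0; last by apply: hd; right.
by rewrite f0 g0.
Qed.

(** * Explicit endomorphisms *)

(** Descending by [F] has unit coefficients on h and s but factors gamma on R; this product is the
    discrepancy accumulated over n steps. *)
Definition gamprod (r i n : nat) : CC := \prod_(l < n) gam r i l.+1.

Lemma gamprod0 r i : gamprod r i 0 = 1.
Proof. exact: big_ord0. Qed.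

Lemma gamprodS r i n : gamprod r i n.+1 = gamprod r i n * gam r i n.+1.
Proof. by rewrite /gamprod big_ord_recr. Qed.

Lemma gamprod_neq0 r i n : (i < r)%N -> (n <= i)%N -> gamprod r i n != 0.
Proof.
move=> hi hn; apply/prodf_neq0 => l _; apply: gam_neq0 => //.
by have := ltn_ord l; lia.
Qed.

Definition parity_ok (r : nat) (nu : bool) (k : int) (i : nat) : bool :=
  (2 %| (k * r%:Z + i%:Z - nu%:Z))%Z.

(** All weights inside P_i have the parity of i, because r + j = 2r-2-i; hence each summand lies
    entirely inside or entirely outside P_nu. *)
Lemma inP_bv r nu k i t n : inP r nu (bv r k i t n) = valid_idx r i t n && parity_ok r nu k i.
Proof.
rewrite /inP validb_bv wt_bv /parity_ok; case hok: (valid_idx r i t n) => //=.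
move: hok (k * r%:Z) => + x; rewrite /valid_idx /weight_in; case: ifP => hi; last by case/and3P=> _ /eqP->; lia.
by rewrite /mirror; case: t => [|[|[|t]]] _; lia.
Qed.

Lemma parity_ok_S r nu k i : (i.+2 <= r)%N -> parity_ok r nu (k + 1) (mirror r i) = parity_ok r nu k i.
Proof. by rewrite /parity_ok mulrDl mul1r; move: (k * r%:Z) => x; rewrite /mirror; lia. Qed.

Lemma parity_ok_P r nu k i : (i.+2 <= r)%N -> parity_ok r nu (k - 1) (mirror r i) = parity_ok r nu k i.
Proof. by rewrite /parity_ok mulrBl mul1r; move: (k * r%:Z) => x; rewrite /mirror; lia. Qed.

(* Coefficients of an endomorphism on the top vector of [P_i]: on [h_i], on [s_i], and
   on the top [L] vector of [P_{r-2-i}] one degree up; [cde] is the coefficient of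
   [h_{-i}] on the lowest [R] vector of [P_{r-2-i}] one degree down, which is the
   normalization that makes the relations of [A] hold without scalars. *)
Record coefs := Coefs { cal : CC; cbe : CC; cga : CC; cde : CC }.

Definition idx_of_weight (r i t : nat) (m : int) : nat := absz ((weight_in r i t 0 - m) %/ 2)%Z.

Lemma idx_of_weightK r i t n : idx_of_weight r i t (weight_in r i t n) = n.
Proof. by rewrite /idx_of_weight /weight_in; case: t => [|[|[|t]]]; lia. Qed.

(** The values are forced by those on h_i. Powers of -1 appear where source and target strings have
    [F] coefficients of opposite sign, since neighbouring degrees have opposite [degsign]; between h
    or s and R the minus in the action on R cancels this sign and leaves the gamma factors. *)
Definition endo_img (r : nat) (nu : bool) (P : nat -> coefs) (b : B0) : seq (CC * B0) :=
  if inP r nu b then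
    let '(k, i, t, m) := b in
    let n := idx_of_weight r i t m in
    let j := mirror r i in
    if (i.+2 <= r)%N then
      match t with
      | 0 => [:: (cal (P i), b); (cbe (P i), bv r k i 1 n);
                 ((-1) ^+ n * cga (P i), bv r (k + 1) j 3 n);
                 (cde (P i) * (gamprod r i n / gamprod r i i), bv r (k - 1) j 2 n)]
      | 1 => [:: (cal (P i), b)]
      | 2 => [:: (cal (P i), b);
                 (cga (P i) * (gamprod r j j / gamprod r j n), bv r (k + 1) j 1 n)]
      | _ => [:: (cal (P i), b);
                 (- ((-1) ^+ n * cde (P i)), bv r (k - 1) j 1 n)]
      end
    else [:: (cal (P i), b)]
  else [::].

Definition endo (r : nat) (nu : bool) (P : nat -> coefs) : Mat :=
  fun b c => lincoef (endo_img r nu P b) c.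

Section Endo.
Variables (r : nat) (nu : bool) (P : nat -> coefs).
Local Notation imgP := (endo_img r nu P).
Local Notation endoP := (endo r nu P).

Lemma endo_img_out b : ~~ inP r nu b -> imgP b = [::].
Proof. by rewrite /endo_img => /negPf ->. Qed.

Lemma endo_img_h k i n : (i.+2 <= r)%N -> (n <= i)%N -> parity_ok r nu k i ->
  imgP (bv r k i 0 n) =
   [:: (cal (P i), bv r k i 0 n); (cbe (P i), bv r k i 1 n);
       ((-1) ^+ n * cga (P i), bv r (k + 1) (mirror r i) 3 n);
       (cde (P i) * (gamprod r i n / gamprod r i i), bv r (k - 1) (mirror r i) 2 n)].
Proof. by move=> hi hn hp; rewrite /endo_img inP_bv valid_idx_h // hn hp /= hi idx_of_weightK. Qed.

Lemma endo_img_s k i n : (i.+2 <= r)%N -> (n <= i)%N -> parity_ok r nu k i ->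
  imgP (bv r k i 1 n) = [:: (cal (P i), bv r k i 1 n)].
Proof. by move=> hi hn hp; rewrite /endo_img inP_bv valid_idx_s // hn hp /= hi. Qed.

Lemma endo_img_R k i n : (i.+2 <= r)%N -> (n <= mirror r i)%N -> parity_ok r nu k i ->
  imgP (bv r k i 2 n) =
   [:: (cal (P i), bv r k i 2 n);
       (cga (P i) * (gamprod r (mirror r i) (mirror r i) / gamprod r (mirror r i) n),
        bv r (k + 1) (mirror r i) 1 n)].
Proof. by move=> hi hn hp; rewrite /endo_img inP_bv valid_idx_R // hn hp /= hi idx_of_weightK. Qed.

Lemma endo_img_L k i n : (i.+2 <= r)%N -> (n <= mirror r i)%N -> parity_ok r nu k i ->
  imgP (bv r k i 3 n) =
   [:: (cal (P i), bv r k i 3 n);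
       (- ((-1) ^+ n * cde (P i)), bv r (k - 1) (mirror r i) 1 n)].
Proof. by move=> hi hn hp; rewrite /endo_img inP_bv valid_idx_L // hn hp /= hi idx_of_weightK. Qed.

Lemma endo_img_v k i n : i.+1 = r -> (n <= i)%N -> parity_ok r nu k i ->
  imgP (bv r k i 0 n) = [:: (cal (P i), bv r k i 0 n)].
Proof. by move=> hi hn hp; rewrite /endo_img inP_bv valid_idx_v // hn hp /= -hi ltnn. Qed.

Lemma endo_img_mem b : all (fun p => (p.2 \in wlist r (wt r b)) && inP r nu p.2) (imgP b).
Proof.
have [hP|/endo_img_out->] := boolP (inP r nu b); last by [].
have /andP[hv _] := hP; move: b hv hP; apply: bv_ind => k i n hi hn;
  rewrite inP_bv => /andP[_ hp].
- rewrite endo_img_h //= !inw_bv !inP_bv valid_idx_h // valid_idx_s // valid_idx_L ?valid_idx_R ?mirror_ltr //.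
  by rewrite mirrorK // parity_ok_S // parity_ok_P // hp hn wt_bv /weight_in mirrorK //; lia.
- by rewrite endo_img_s //= inw_bv inP_bv hp valid_idx_s // wt_bv hn /weight_in; lia.
- rewrite endo_img_R //= !inw_bv !inP_bv valid_idx_R // valid_idx_s ?mirror_ltr // parity_ok_S // hp hn wt_bv /weight_in; lia.
- rewrite endo_img_L //= !inw_bv !inP_bv valid_idx_L // valid_idx_s ?mirror_ltr // parity_ok_P // hp hn wt_bv /weight_in; lia.
- by rewrite endo_img_v //= inw_bv inP_bv hp valid_idx_v // wt_bv hn /weight_in; lia.
Qed.

Lemma sum_endo b (g : B0 -> CC) :
  \sum_(c <- wlist r (wt r b)) endoP b c * g c = \sum_(p <- imgP b) p.1 * g p.2.
Proof.
by apply: sum_lincoef; apply: sub_all (endo_img_mem b) => p /andP[].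
Qed.

Lemma Eimg_inP b p : p \in Eimg r b -> validb r b -> inP r nu p.2 = inP r nu b.
Proof.
move=> hp hv; have /allP/(_ p hp) := Eimg_mem r b.
by rewrite mem_wlist /inP hv => /andP[-> /eqP->] /=; lia.
Qed.

Lemma Fimg_inP b p : p \in Fimg r b -> validb r b -> inP r nu p.2 = inP r nu b.
Proof.
move=> hp hv; have /allP/(_ p hp) := Fimg_mem r b.
by rewrite mem_wlist /inP hv => /andP[-> /eqP->] /=; lia.
Qed.

Lemma endo_comE : commutes r endoP (Ecoef r) 2.
Proof.
move=> b d; rewrite sum_endo.
rewrite -[RHS]/(\sum_(c <- wlist r (wt r b + 2)) lincoef (Eimg r b) c * endoP c d).
rewrite (sum_lincoef (fun c => endoP c d) (Eimg_mem r b)).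
have [hv|hv] := boolP (validb r b); last first.
  by rewrite Eimg_invalid // endo_img_out ?big_nil // /inP negb_and hv.
have [hP|hP] := boolP (inP r nu b); last first.
  rewrite endo_img_out // big_nil big1_seq // => p /andP[_ hp].
  by rewrite /endo endo_img_out ?lincoef_nil ?mulr0 // (Eimg_inP hp).
move: b hv hP; apply: bv_ind => k i [|n] hi hn; rewrite inP_bv => /andP[_ hp].
(* At the top of h: [E] turns the L component into the bottom of s, which must be the image of the
   bottom of R. This fixes the numerator [gamprod r j j] in the coefficient on R. *)
- have hj := mirror_ltr hi; have hgi : gamprod r i i != 0 by apply: gamprod_neq0; lia.
  have hgj : gamprod r (mirror r i) (mirror r i) != 0 by apply: gamprod_neq0; lia.
  rewrite endo_img_h // Eimg_h0 //; rowsimp; rewrite /endo endo_img_R // !EcoefE.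
  rewrite Eimg_h0 // Eimg_s0 // Eimg_L0 // Eimg_R0 //; rowsimp; field; exact/andP.
- have hj := mirror_ltr hi; have hgi : gamprod r i i != 0 by apply: gamprod_neq0; lia.
  have hn' := ltnW hn.
  rewrite endo_img_h // Eimg_hS //; rowsimp; rewrite /endo endo_img_h // endo_img_s // !EcoefE.
  rewrite Eimg_hS // Eimg_sS // Eimg_LS ?mirrorK // Eimg_RS ?mirrorK //; rowsimp.
  by rewrite gamprodS exprS; field.
- by rewrite endo_img_s // Eimg_s0 //; rowsimp; rewrite EcoefE Eimg_s0 //; rowsimp; ring.
- rewrite endo_img_s // Eimg_sS //; rowsimp; rewrite /endo endo_img_s ?(ltnW hn) // EcoefE.
  by rewrite Eimg_sS //; rowsimp; ring.
- have hj := mirror_ltr hi; rewrite endo_img_R // Eimg_R0 //; rowsimp.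
  by rewrite !EcoefE Eimg_R0 // Eimg_s0 //; rowsimp; ring.
- have hj := mirror_ltr hi.
  have hgj : gamprod r (mirror r i) n != 0 by apply: gamprod_neq0; lia.
  have hgjS : gam r (mirror r i) n.+1 != 0 by apply: gam_neq0; lia.
  rewrite endo_img_R // Eimg_RS //; rowsimp; rewrite /endo endo_img_R ?(ltnW hn) // !EcoefE.
  by rewrite Eimg_RS // Eimg_sS //; rowsimp; rewrite gamprodS; field; apply/andP.
- have hj := mirror_ltr hi; rewrite endo_img_L // Eimg_L0 //; rowsimp.
  by rewrite !EcoefE Eimg_L0 // Eimg_s0 // /endo endo_img_s //; rowsimp; ring.
- have hj := mirror_ltr hi.
  rewrite endo_img_L // Eimg_LS //; rowsimp; rewrite /endo endo_img_L ?(ltnW hn) // !EcoefE.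
  by rewrite Eimg_LS // Eimg_sS //; rowsimp; rewrite exprS; ring.
- by rewrite endo_img_v // Eimg_v0 //; rowsimp; rewrite EcoefE Eimg_v0 //; rowsimp; ring.
- rewrite endo_img_v // Eimg_vS //; rowsimp; rewrite /endo endo_img_v ?(ltnW hn) // EcoefE.
  by rewrite Eimg_vS //; rowsimp; ring.
Qed.

Lemma endo_comF : commutes r endoP (Fcoef r) (- 2).
Proof.
move=> b d; rewrite sum_endo.
rewrite -[RHS]/(\sum_(c <- wlist r (wt r b - 2)) lincoef (Fimg r b) c * endoP c d).
rewrite (sum_lincoef (fun c => endoP c d) (Fimg_mem r b)).
have [hv|hv] := boolP (validb r b); last first.
  by rewrite Fimg_invalid // endo_img_out ?big_nil // /inP negb_and hv.
have [hP|hP] := boolP (inP r nu b); last first.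
  rewrite endo_img_out // big_nil big1_seq // => p /andP[_ hp].
  by rewrite /endo endo_img_out ?lincoef_nil ?mulr0 // (Fimg_inP hp).
move: b hv hP; apply: bv_ind => k i n hi; rewrite inP_bv => + /andP[_ hp];
  rewrite leq_eqVlt => /orP[/eqP->|hn]; have r0 : (0 < r)%N by lia.
(* At the bottom of h: [F] leads to the top of L, while on the R component, of degree k - 1, it acts
   with the opposite sign. This produces the minus in the coefficient on L. *)
- have hj := mirror_ltr hi; have hgi : gamprod r i i != 0 by apply: gamprod_neq0; lia.
  rewrite endo_img_h // Fimg_hi //; rowsimp; rewrite /endo endo_img_L // !FcoefE.
  rewrite Fimg_hi // Fimg_si //.
  have := Fimg_Lj (k + 1) hj; have := Fimg_Rj (k - 1) hj; rewrite mirrorK // => -> ->.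
  by rowsimp; rewrite degsignP // expr0; field.
- have hj := mirror_ltr hi; have hgi : gamprod r i i != 0 by apply: gamprod_neq0; lia.
  have hn' := ltnW hn.
  rewrite endo_img_h // Fimg_h //; rowsimp; rewrite /endo endo_img_h // !FcoefE.
  rewrite Fimg_h // Fimg_s // Fimg_L ?mirrorK // Fimg_R ?mirrorK //; rowsimp.
  by rewrite gamprodS exprS degsignP // degsignS //; field.
- by rewrite endo_img_s // Fimg_si //; rowsimp; rewrite FcoefE Fimg_si //; rowsimp; ring.
- rewrite endo_img_s ?(ltnW hn) // Fimg_s //; rowsimp; rewrite /endo endo_img_s // FcoefE.
  by rewrite Fimg_s //; rowsimp; ring.
- have hj := mirror_ltr hi; rewrite endo_img_R // Fimg_Rj //; rowsimp.
  by rewrite !FcoefE Fimg_Rj // Fimg_si // /endo endo_img_s //; rowsimp; ring.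
- have hj := mirror_ltr hi.
  have hgj : gamprod r (mirror r i) n != 0 by apply: gamprod_neq0; lia.
  have hgjS : gam r (mirror r i) n.+1 != 0 by apply: gam_neq0; lia.
  rewrite endo_img_R ?(ltnW hn) // Fimg_R //; rowsimp; rewrite /endo endo_img_R // !FcoefE.
  rewrite Fimg_R // Fimg_s //; rowsimp; rewrite gamprodS degsignS //; field; exact/andP.
- have hj := mirror_ltr hi; rewrite endo_img_L // Fimg_Lj //; rowsimp.
  by rewrite !FcoefE Fimg_Lj // Fimg_si //; rowsimp; ring.
- have hj := mirror_ltr hi.
  rewrite endo_img_L ?(ltnW hn) // Fimg_L //; rowsimp; rewrite /endo endo_img_L // !FcoefE.
  by rewrite Fimg_L // Fimg_s //; rowsimp; rewrite exprS degsignP //; ring.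
- by rewrite endo_img_v // Fimg_vi //; rowsimp; rewrite FcoefE Fimg_vi //; rowsimp; ring.
- rewrite endo_img_v ?(ltnW hn) // Fimg_v //; rowsimp; rewrite /endo endo_img_v // FcoefE.
  by rewrite Fimg_v //; rowsimp; ring.
Qed.

Lemma endo_img_sigma b :
  imgP (sigma_shift r b) = [seq (p.1, sigma_shift r p.2) | p <- imgP b].
Proof.
rewrite /endo_img inP_sigma; case: ifP => // _; rewrite sigma_kshift.
case: b => [[[k i] t] m] /=; case: ifP => // _.
by case: t => [|[|[|t]]] //=; rewrite /bv -/(sigma_step r) ?[k + _ + sigma_step r]addrAC.
Qed.

Lemma endo_inEnd : inEnd r nu endoP.
Proof.
have hmem b c : endoP b c != 0 -> [/\ inP r nu b, inP r nu c & wt r c = wt r b].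
  move=> h; have [hb|hb] := boolP (inP r nu b); last first.
    by move: h; rewrite /endo endo_img_out // lincoef_nil eqxx.
  suff /hasP[p hp /eqP <-] : has (fun p => p.2 == c) (imgP b).
    have /allP/(_ p hp)/andP[] := endo_img_mem b; rewrite mem_wlist.
    by case/andP=> _ /eqP -> ->.
  apply/negPn/negP => /hasPn hn; move/eqP: h; apply.
  by rewrite /endo /lincoef big1_seq // => p /andP[_ /hn/negPf ->].
apply: inEndI.
- by move=> b c; apply: contraNeq => /hmem[-> ->].
- by move=> b c; apply: contraNeq => /hmem[_ _ ->].
- exact: endo_comE.
- exact: endo_comF.
- move=> b c; rewrite /endo endo_img_sigma /lincoef big_map; apply: eq_bigr => p _ /=.
  by rewrite !sigma_kshift (inj_eq (@kshift_inj _)).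
Qed.

End Endo.

(** * Coefficients of endomorphisms and their composition *)

(** For odd r the copies of P_i inside P_nu are those with k congruent to i + nu mod 2; for even r
    the parity of k is free. This representative suits both cases. *)
Definition base_deg (nu : bool) (i : nat) : int := (odd (i + nu) : nat)%:Z.

(** The indices i for which some degree shift of P_i lies in P_nu. *)
Definition iset (r : nat) (nu : bool) (i : nat) : bool := odd r || (odd i == nu).

Lemma parity_ok_base r nu i : parity_ok r nu (base_deg nu i) i = iset r nu i.
Proof.
rewrite /parity_ok /base_deg /iset; case: nu; rewrite /= ?addn1 ?addn0 /=;
  case: (boolP (odd i)) => hi; case: (boolP (odd r)) => hr; rewrite /= ?mul1r ?mul0r; lia.
Qed.

(* The factor [gamprod r i i] converts the [R] coefficient at [h_i] into that at [h_{-i}]. *)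
Definition coef_of (r : nat) (nu : bool) (f : Mat) (i : nat) : coefs :=
  let k := base_deg nu i in
  Coefs (f (bv r k i 0 0) (bv r k i 0 0))
        (f (bv r k i 0 0) (bv r k i 1 0))
        (f (bv r k i 0 0) (bv r (k + 1) (mirror r i) 3 0))
        (gamprod r i i * f (bv r k i 0 0) (bv r (k - 1) (mirror r i) 2 0)).

Lemma parity_ok_iset r nu k i : parity_ok r nu k i -> iset r nu i.
Proof.
rewrite /parity_ok /iset; case: (boolP (odd r)) => //= hr.
have -> : k * r%:Z = 2 * (k * (r./2)%:Z) by rewrite -{1}(even_halfK hr); lia.
by move: (k * _) => x; case: nu; lia.
Qed.

Section Coefficients.
Variables (r : nat) (nu : bool).
Implicit Types (f g : Mat) (P Q : nat -> coefs).

Lemma inEnd_shift f (z : int) b c : inEnd r nu f ->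
  f (kshift (z * sigma_step r) b) (kshift (z * sigma_step r) c) = f b c.
Proof.
case=> _ _ _ _ hs.
have kk x y (d : B0) : kshift x (kshift y d) = kshift (y + x) d.
  by case: d => [[[k i] t] m] /=; rewrite addrA.
have hn (n : nat) b' c' : f (kshift (n%:Z * sigma_step r) b') (kshift (n%:Z * sigma_step r) c') = f b' c'.
  elim: n b' c' => [|n IH] b' c'.
    by rewrite mul0r; case: b' c' => [[[? ?] ?] ?] [[[? ?] ?] ?] /=; rewrite !addr0.
  have -> : n.+1%:Z * sigma_step r = n%:Z * sigma_step r + sigma_step r by lia.
  by rewrite -!kk -!sigma_kshift hs IH.
case: z => n; first exact: hn.
by rewrite -(hn n.+1 (kshift _ b)) !kk NegzE mulNr addNr -(hn 0%N b c) mul0r.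
Qed.

(** The admissible degrees form one orbit of sigma: for odd r their parity is fixed and the step is
    2, for even r the step is 1. *)
Lemma base_deg_shift k i : (0 < r)%N -> parity_ok r nu k i -> exists z, k = base_deg nu i + z * sigma_step r.
Proof.
move=> r0; rewrite /parity_ok /base_deg; have [hr|hr] := boolP (odd r).
  rewrite (sigma_step_odd hr) => h; exists ((k - (odd (i + nu) : nat)%:Z) %/ 2)%Z.
  have : (2 %| (k + i%:Z - nu%:Z))%Z.
    (* As r is odd, kr and k agree mod 2. *)
    have -> : k + i%:Z - nu%:Z = k * r%:Z + i%:Z - nu%:Z - (k * (r./2)%:Z) * 2.
      have er : r%:Z = 1 + 2 * (r./2)%:Z :> int by lia.
      by rewrite {1}er; ring.
    by rewrite rpredB // dvdz_mull.
  by case: nu {h}; rewrite /= ?addn1 ?addn0 /=; lia.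
by exists (k - (odd (i + nu) : nat)%:Z); rewrite sigma_step_even // mulr1; lia.
Qed.

Lemma coef_ofP f k i : inEnd r nu f -> (0 < r)%N -> parity_ok r nu k i ->
  [/\ f (bv r k i 0 0) (bv r k i 0 0) = cal (coef_of r nu f i),
      f (bv r k i 0 0) (bv r k i 1 0) = cbe (coef_of r nu f i),
      f (bv r k i 0 0) (bv r (k + 1) (mirror r i) 3 0) = cga (coef_of r nu f i) &
      gamprod r i i * f (bv r k i 0 0) (bv r (k - 1) (mirror r i) 2 0) = cde (coef_of r nu f i)].
Proof.
move=> hf r0 /(base_deg_shift r0)[z ->]; rewrite /coef_of /=.
by split; rewrite ?[_ + _ * _ + 1]addrAC ?[_ + _ * _ - 1]addrAC -!kshift_bv inEnd_shift.
Qed.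

Lemma endo_h0 P k i : (i.+2 <= r)%N -> parity_ok r nu k i ->
  [/\ endo r nu P (bv r k i 0 0) (bv r k i 0 0) = cal (P i),
      endo r nu P (bv r k i 0 0) (bv r k i 1 0) = cbe (P i),
      endo r nu P (bv r k i 0 0) (bv r (k + 1) (mirror r i) 3 0) = cga (P i) &
      gamprod r i i * endo r nu P (bv r k i 0 0) (bv r (k - 1) (mirror r i) 2 0) = cde (P i)].
Proof.
move=> hi hp; have hg : gamprod r i i != 0 by apply: gamprod_neq0; lia.
rewrite /endo endo_img_h //; split; rowsimp; rewrite !bv_eq !eqxx /= !andbF /= ?gamprod0 ?expr0;
  by [ring|field].
Qed.

Lemma endo_v0 P k i : i.+1 = r -> parity_ok r nu k i ->
  endo r nu P (bv r k i 0 0) (bv r k i 0 0) = cal (P i).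
Proof. by move=> hi hp; rewrite /endo endo_img_v //; rowsimp; rewrite eqxx /=; ring. Qed.

Lemma endo_coef_of f : inEnd r nu f -> f = endo r nu (coef_of r nu f).
Proof.
move=> hf; apply: (inEnd_eq hf (endo_inEnd _ _ _)) => k i hi; rewrite inP_bv => /andP[_ hp].
  have r0 : (0 < r)%N by lia.
  have [f1 f2 f3 f4] := coef_ofP hf r0 hp.
  have [e1 e2 e3 e4] := endo_h0 (coef_of r nu f) hi hp.
  have hg : gamprod r i i != 0 by apply: gamprod_neq0; lia.
  by rewrite f1 f2 f3 e1 e2 e3; split=> //; apply: (mulfI hg); rewrite f4 e4.
have r0 : (0 < r)%N by lia.
by have [f1 _ _ _] := coef_ofP hf r0 hp; rewrite f1 endo_v0.
Qed.

(** Families with the same [endo]: only indices in [iset] count, and for the simple summand only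
    [cal], as it has no s, L or R. *)
Definition ceq P Q : Prop :=
  (forall i, (i.+2 <= r)%N -> iset r nu i -> P i = Q i) /\
  (forall i, i.+1 = r -> iset r nu i -> cal (P i) = cal (Q i)).

Lemma coef_of_endo P : ceq (coef_of r nu (endo r nu P)) P.
Proof.
split=> i hi; rewrite -parity_ok_base => hp; last by rewrite /coef_of /= endo_v0.
have [e1 e2 e3 e4] := endo_h0 P hi hp.
by rewrite /coef_of e1 e2 e3 e4; case: (P i).
Qed.

Lemma endo_ceq P Q : ceq P Q -> endo r nu P = endo r nu Q.
Proof.
move=> [h1 h2]; apply: (@inEnd_eq r nu); try exact: endo_inEnd.
- move=> k i hi; rewrite inP_bv => /andP[_ hp].
  have hP : P i = Q i by apply: h1 => //; apply: parity_ok_iset hp.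
  have [e1 e2 e3 e4] := endo_h0 P hi hp; have [e1' e2' e3' e4'] := endo_h0 Q hi hp.
  have hg : gamprod r i i != 0 by apply: gamprod_neq0; lia.
  by rewrite e1 e2 e3 e1' e2' e3' hP; split=> //; apply: (mulfI hg); rewrite e4 e4' hP.
- move=> k i hi; rewrite inP_bv => /andP[_ hp]; rewrite !endo_v0 //.
  by apply: h2 => //; apply: parity_ok_iset hp.
Qed.

Lemma endo_one :
  endo r nu (fun=> Coefs 1 0 0 0) = (fun b c => if inP r nu b && (b == c) then 1 else 0).
Proof.
apply: functional_extensionality => b; apply: functional_extensionality => c.
rewrite /endo; have [hP|/endo_img_out-> /=] := boolP (inP r nu b); last by rewrite lincoef_nil.
have -> : (if true && (b == c) then 1 else 0) = (b == c)%:R :> CC by case: eqP.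
have /andP[hv _] := hP; move: b hv hP; apply: bv_ind => k i n hi hn;
  rewrite inP_bv => /andP[_ hp].
- by rewrite endo_img_h //; rowsimp; ring.
- by rewrite endo_img_s //; rowsimp; ring.
- by rewrite endo_img_R //; rowsimp; ring.
- by rewrite endo_img_L //; rowsimp; ring.
- by rewrite endo_img_v //; rowsimp; ring.
Qed.

(** P is applied after Q. In the second entry the last two terms are the ways from h_i to s_i
    through R and through L of P_{r-2-i}; their opposite signs become the anticommutation in A. *)
Definition cmul P Q (i : nat) : coefs :=
  let j := mirror r i in
  Coefs (cal (P i) * cal (Q i))
    (cbe (P i) * cal (Q i) + cal (P i) * cbe (Q i)
     + cga (P j) * cde (Q i) - cde (P j) * cga (Q i))
    (cga (P i) * cal (Q i) + cal (P j) * cga (Q i))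
    (cde (P i) * cal (Q i) + cal (P j) * cde (Q i)).

Lemma coef_of_mul f g : inEnd r nu f -> inEnd r nu g ->
  ceq (coef_of r nu (fun b d => \sum_(c <- wlist r (wt r b)) g b c * f c d))
      (cmul (coef_of r nu f) (coef_of r nu g)).
Proof.
move=> hf hg; rewrite (endo_coef_of hf) (endo_coef_of hg).
have [cf1 cf2] := coef_of_endo (coef_of r nu f).
have [cg1 cg2] := coef_of_endo (coef_of r nu g).
move: (coef_of r nu f) (coef_of r nu g) cf1 cf2 cg1 cg2 => P Q cP1 cP2 cQ1 cQ2.
split=> i hi hI; have := hI; rewrite -parity_ok_base; set k := base_deg nu i => hp; last first.
  rewrite -[RHS]/(cal (coef_of r nu (endo r nu P) i) * cal (coef_of r nu (endo r nu Q) i)).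
  rewrite cP2 // cQ2 // /coef_of /= -/k sum_endo endo_img_v //.
  by rowsimp; rewrite endo_v0 //; ring.
have hj := mirror_ltr hi; have hIj : iset r nu (mirror r i).
  by move: hI; rewrite /iset /mirror; lia.
have hgi : gamprod r i i != 0 by apply: gamprod_neq0; lia.
rewrite /cmul cP1 // cQ1 // cP1 // /coef_of -/k !sum_endo !endo_img_h //.
rowsimp; rewrite /endo endo_img_h // endo_img_s // endo_img_L ?parity_ok_S // endo_img_R ?parity_ok_P // mirrorK //.
rewrite addrK subrK; rowsimp; rewrite !bv_eq !eqxx /= !andbF /= !gamprod0 !expr0.
by congr Coefs; field.
Qed.

End Coefficients.

Definition cadd (P Q : nat -> coefs) (i : nat) : coefs :=
  Coefs (cal (P i) + cal (Q i)) (cbe (P i) + cbe (Q i))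
        (cga (P i) + cga (Q i)) (cde (P i) + cde (Q i)).

Definition cscl (a : CC) (P : nat -> coefs) (i : nat) : coefs :=
  Coefs (a * cal (P i)) (a * cbe (P i)) (a * cga (P i)) (a * cde (P i)).

(** Leaves the module behind: it remains to encode families of coefficients in Y so that the fibres
    are the classes of [ceq] and [cmul] becomes the product. *)
Lemma Anu_isoI (r : nat) (nu : bool) (Y : AlgOps) (enc : (nat -> coefs) -> Y) :
  (forall P Q, ceq r nu P Q <-> enc P = enc Q) ->
  (forall P Q, enc (cadd P Q) = ao_add (enc P) (enc Q)) ->
  (forall P Q, enc (cmul r P Q) = ao_mul (enc P) (enc Q)) ->
  (forall a P, enc (cscl a P) = ao_scl a (enc P)) ->
  enc (fun=> Coefs 1 0 0 0) = ao_one Y ->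
  (forall z, exists P, enc P = z) ->
  Anu_iso r nu Y.
Proof.
move=> hE hadd hmul hscl hone hsurj; split.
  split=> [|a f g hf hg]; first by rewrite /= -endo_one; apply: endo_inEnd.
  by split; [apply: inEnd_add|apply: inEnd_mul|apply: inEnd_scl].
exists (fun f => enc (coef_of r nu f)); split.
- split=> f g hf hg; last by rewrite -hmul; apply/hE; apply: coef_of_mul.
  rewrite -hadd; congr enc; apply: functional_extensionality => i.
  by rewrite /coef_of /cadd /= mulrDr.
- move=> a f hf; rewrite -hscl; congr enc; apply: functional_extensionality => i.
  by rewrite /coef_of /cscl /= mulrCA.
- by rewrite -hone /= -endo_one; apply/hE; apply: coef_of_endo.
- move=> f g hf hg /hE h.
  by rewrite (endo_coef_of hf) (endo_coef_of hg); apply: endo_ceq.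
- move=> z; have [P <-] := hsurj z; exists (endo r nu P); first exact: endo_inEnd.
  by apply/hE; apply: coef_of_endo.
Qed.

(** * Identification with A, B and C *)

(** Vertex p stands for i and q for r-2-i. Arrows leaving i are the a's, arrows leaving r-2-i the
    b's, with + for L (degree up) and - for R (degree down); the loops [b_+ a_-] and [a_+ b_-] are
    the two nilpotents h to s. *)
Definition encA (r i : nat) (P : nat -> coefs) : A_ops :=
  fun l : 'I_8 =>
  match nat_of_ord l with
  | 0 => cal (P i) | 1 => cal (P (mirror r i))
  | 2 => cga (P i) | 3 => cde (P i)
  | 4 => cga (P (mirror r i)) | 5 => cde (P (mirror r i))
  | 6 => cbe (P i) | _ => cbe (P (mirror r i))
  end.

Definition encB (i : nat) (P : nat -> coefs) : B_ops :=
  fun l : 'I_4 =>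
  match nat_of_ord l with
  | 0 => cal (P i) | 1 => cga (P i) | 2 => cde (P i) | _ => cbe (P i)
  end.

Lemma encA_mul r i P Q : (i.+2 <= r)%N ->
  encA r i (cmul r P Q) = ao_mul (encA r i P) (encA r i Q).
Proof.
move=> hi; apply: functional_extensionality => -[l hl].
rewrite /= /sc_mul; under eq_bigr do rewrite !big_ord_recr big_ord0 /= .
rewrite !big_ord_recr big_ord0 /= /encA /cmul /= mirrorK //.
by case: l hl => [|[|[|[|[|[|[|[|l]]]]]]]] //= _; ring.
Qed.

Lemma encA_add r i P Q : encA r i (cadd P Q) = ao_add (encA r i P) (encA r i Q).
Proof.
apply: functional_extensionality => -[l hl]; rewrite /encA /=.
by case: l {hl} => [|[|[|[|[|[|[|l]]]]]]].
Qed.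

Lemma encA_scl r i a P : encA r i (cscl a P) = ao_scl a (encA r i P).
Proof.
apply: functional_extensionality => -[l hl]; rewrite /encA /=.
by case: l {hl} => [|[|[|[|[|[|[|l]]]]]]].
Qed.

Lemma encA_one r i : encA r i (fun=> Coefs 1 0 0 0) = ao_one A_ops.
Proof.
apply: functional_extensionality => -[l hl]; rewrite /encA /=.
by case: l {hl} => [|[|[|[|[|[|[|l]]]]]]].
Qed.

Lemma encB_mul r i P Q : mirror r i = i ->
  encB i (cmul r P Q) = ao_mul (encB i P) (encB i Q).
Proof.
move=> hi; apply: functional_extensionality => -[l hl].
rewrite /= /sc_mul; under eq_bigr do rewrite !big_ord_recr big_ord0 /= .
rewrite !big_ord_recr big_ord0 /= /encB /cmul /= hi.
by case: l hl => [|[|[|[|l]]]] //= _; ring.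
Qed.

Lemma encB_add i P Q : encB i (cadd P Q) = ao_add (encB i P) (encB i Q).
Proof.
apply: functional_extensionality => -[l hl]; rewrite /encB /=.
by case: l {hl} => [|[|[|l]]].
Qed.

Lemma encB_scl i a P : encB i (cscl a P) = ao_scl a (encB i P).
Proof.
apply: functional_extensionality => -[l hl]; rewrite /encB /=.
by case: l {hl} => [|[|[|l]]].
Qed.

Lemma encB_one i : encB i (fun=> Coefs 1 0 0 0) = ao_one B_ops.
Proof.
apply: functional_extensionality => -[l hl]; rewrite /encB /=.
by case: l {hl} => [|[|[|l]]].
Qed.

Lemma coefs_ext (x y : coefs) : cal x = cal y -> cbe x = cbe y -> cga x = cga y ->
  cde x = cde y -> x = y.
Proof. by case: x; case: y => ? ? ? ? ? ? ? ? /= -> -> -> ->. Qed.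

Lemma encA_inj r i P Q : encA r i P = encA r i Q -> P i = Q i /\ P (mirror r i) = Q (mirror r i).
Proof.
move=> h; have e n (hn : (n < 8)%N) := congr1 (fun x : 'I_8 -> CC => x (Ordinal hn)) h.
split; apply: coefs_ext.
- exact: (e 0%N isT).
- exact: (e 6%N isT).
- exact: (e 2%N isT).
- exact: (e 3%N isT).
- exact: (e 1%N isT).
- exact: (e 7%N isT).
- exact: (e 4%N isT).
- exact: (e 5%N isT).
Qed.

Lemma encB_inj i P Q : encB i P = encB i Q -> P i = Q i.
Proof.
move=> h; have e n (hn : (n < 4)%N) := congr1 (fun x : 'I_4 -> CC => x (Ordinal hn)) h.
apply: coefs_ext.
- exact: (e 0%N isT).
- exact: (e 3%N isT).
- exact: (e 1%N isT).
- exact: (e 2%N isT).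
Qed.

Definition decA (x : A_ops) (fst : bool) : coefs :=
  let c n := x (@inord 7 n) in
  if fst then Coefs (c 0%N) (c 6) (c 2) (c 3) else Coefs (c 1%N) (c 7) (c 4) (c 5).

Definition decB (x : B_ops) : coefs :=
  let c n := x (@inord 3 n) in Coefs (c 0%N) (c 3) (c 1%N) (c 2).

Lemma encA_dec r i P x : P i = decA x true -> P (mirror r i) = decA x false ->
  encA r i P = x.
Proof.
move=> h1 h2; apply: functional_extensionality => -[l hl].
rewrite /encA /= h1 h2 /=.
have -> : Ordinal hl = @inord 7 l by apply: val_inj; rewrite /= inordK.
by case: l hl => [|[|[|[|[|[|[|[|l]]]]]]]].
Qed.

Lemma encB_dec i P x : P i = decB x -> encB i P = x.
Proof.
move=> h; apply: functional_extensionality => -[l hl].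
rewrite /encB /= h /=.
have -> : Ordinal hl = @inord 3 l by apply: val_inj; rewrite /= inordK.
by case: l hl => [|[|[|[|l]]]].
Qed.

Definition encAs (r N : nat) (idx : nat -> nat) (P : nat -> coefs) : pow_ops A_ops N :=
  fun l => encA r (idx l) P.

(** Extended by 0 to all natural numbers, so that [dec] makes sense at every index. *)
Definition getA (N : nat) (x : pow_ops A_ops N) (l : nat) : A_ops :=
  if insub l is Some o then x o else (fun=> 0).

Lemma getA_ord N (x : pow_ops A_ops N) (l : 'I_N) : getA x l = x l.
Proof. by rewrite /getA valK. Qed.

(* A list of representatives [idx 0, ..., idx (N-1)] of the two-element orbits of
   [i <-> r-2-i] in [iset r nu], with left inverse [rk]. *)
Definition orbit_reps (r : nat) (nu : bool) (N : nat) (idx rk : nat -> nat) : Prop :=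
  (forall l, (l < N)%N -> [/\ ((idx l).+2 <= r)%N, (idx l < mirror r (idx l))%N,
     iset r nu (idx l) & rk (idx l) = l]) /\
  (forall i, (i.+2 <= r)%N -> (i < mirror r i)%N -> iset r nu i -> exists2 l, (l < N)%N & i = idx l).

(** * Assembling the factors over the orbits of i <-> r-2-i *)

Section Assemble.
Variables (r : nat) (nu : bool) (N : nat) (idx rk : nat -> nat).
Hypothesis reps : orbit_reps r nu N idx rk.

(** A family with prescribed encodings. The cases are the simple summand, the smaller and the larger
    element of an orbit, and the fixed point. *)
Definition dec (x : pow_ops A_ops N) (y : B_ops) (z : CC) (i : nat) : coefs :=
  if i.+1 == r then Coefs z 0 0 0
  else if (i < mirror r i)%N then decA (getA x (rk i)) true
  else if (mirror r i < i)%N then decA (getA x (rk (mirror r i))) false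
  else decB y.

Lemma encAs_mul P Q : encAs r idx (cmul r P Q) = ao_mul (encAs r idx P) (encAs r idx Q) :> pow_ops A_ops N.
Proof.
apply: functional_extensionality => l; rewrite /encAs encA_mul //.
by have [h _] := reps; have [] := h l (ltn_ord l).
Qed.

Lemma encAs_dec x y z : encAs r idx (dec x y z) = x.
Proof.
apply: functional_extensionality => l; rewrite /encAs -getA_ord.
have [h _] := reps; have [h1 h2 h3 h4] := h l (ltn_ord l).
have hj := mirror_ltr h1; have hjj := mirrorK h1.
apply: encA_dec; rewrite /dec; first by rewrite h2 h4 ifF //; lia.
by rewrite hjj h4 h2 !ifF //; lia.
Qed.

Lemma encB_dec_mid x y z i : (i.+2 <= r)%N -> mirror r i = i -> encB i (dec x y z) = y.
Proof.
by move=> hi h; apply: encB_dec; rewrite /dec h ltnn ifF //; lia.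
Qed.

Lemma cal_dec x y z i : i.+1 = r -> cal (dec x y z i) = z.
Proof. by rewrite /dec => ->; rewrite eqxx. Qed.

Lemma encAs_inj P Q : encAs r idx P = encAs r idx Q :> pow_ops A_ops N ->
  forall i, (i.+2 <= r)%N -> iset r nu i -> i != mirror r i -> P i = Q i.
Proof.
move=> h i hi hI; have [_ h2] := reps.
have e l : (l < N)%N -> encA r (idx l) P = encA r (idx l) Q.
  by move=> hl; apply: (congr1 (fun x : pow_ops A_ops N => x (Ordinal hl)) h).
rewrite neq_ltn => /orP[hlt|hlt].
  by have [l hl ->] := h2 i hi hlt hI; have [] := encA_inj (e l hl).
have hIj : iset r nu (mirror r i) by move: hI; rewrite /iset /mirror; lia.
have [|l hl hjl] := h2 _ (mirror_ltr hi) _ hIj; first by rewrite mirrorK.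
by have [_] := encA_inj (e l hl); rewrite -hjl mirrorK.
Qed.

Lemma encAs_ext P Q : ceq r nu P Q -> encAs r idx P = encAs r idx Q :> pow_ops A_ops N.
Proof.
move=> [h _]; apply: functional_extensionality => l; rewrite /encAs.
have [hr _] := reps; have [h1 h2 h3 h4] := hr l (ltn_ord l).
have hIj : iset r nu (mirror r (idx l)) by move: h3; rewrite /iset /mirror; lia.
by rewrite /encA h // h // mirror_ltr.
Qed.

Lemma encAs_add P Q : encAs r idx (cadd P Q) = ao_add (encAs r idx P) (encAs r idx Q) :> pow_ops A_ops N.
Proof. by apply: functional_extensionality => l; rewrite /encAs encA_add. Qed.

Lemma encAs_scl a P : encAs r idx (cscl a P) = ao_scl a (encAs r idx P) :> pow_ops A_ops N.
Proof. by apply: functional_extensionality => l; rewrite /encAs encA_scl. Qed.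

Lemma encAs_one : encAs r idx (fun=> Coefs 1 0 0 0) = ao_one (pow_ops A_ops N).
Proof. by apply: functional_extensionality => l; rewrite /encAs encA_one. Qed.

Let no_mid := forall i, (i.+2 <= r)%N -> iset r nu i -> i != mirror r i.

Lemma iso_A : no_mid -> ~~ iset r nu r.-1 -> Anu_iso r nu (pow_ops A_ops N).
Proof.
move=> hm ht; have ht' i : i.+1 = r -> ~~ iset r nu i by move=> hi; have <- : r.-1 = i by lia.
apply: (Anu_isoI (enc := encAs r idx)).
- move=> P Q; split=> [|h]; first exact: encAs_ext.
  split=> i hi hI; first by apply: encAs_inj => //; apply: hm.
  by move: (ht' i hi); rewrite hI.
- exact: encAs_add.
- exact: encAs_mul.
- exact: encAs_scl.
- exact: encAs_one.
- by move=> x; exists (dec x (fun=> 0) 0); apply: encAs_dec.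
Qed.

Lemma iso_AC : (0 < r)%N -> no_mid -> iset r nu r.-1 ->
  Anu_iso r nu (prod_ops (pow_ops A_ops N) C_ops).
Proof.
move=> r0 hm ht.
apply: (@Anu_isoI _ _ (prod_ops (pow_ops A_ops N) C_ops)
  (fun P => (encAs r idx P, cal (P r.-1)))).
- move=> P Q; split=> [h|[hA hC]].
    by rewrite (encAs_ext h); case: h => _ h; rewrite h // prednK.
  split=> i hi hI; first by apply: encAs_inj => //; apply: hm.
  by move: hC; rewrite -hi.
- by move=> P Q; rewrite encAs_add.
- by move=> P Q; rewrite encAs_mul.
- by move=> a P; rewrite encAs_scl.
- by rewrite encAs_one.
- by move=> [x z]; exists (dec x (fun=> 0) z); rewrite encAs_dec cal_dec // prednK.
Qed.

Lemma iso_AB m : (m.+2 <= r)%N -> mirror r m = m -> iset r nu m -> ~~ iset r nu r.-1 ->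
  Anu_iso r nu (prod_ops (pow_ops A_ops N) B_ops).
Proof.
move=> hm hjm hIm ht.
have ht' i : i.+1 = r -> ~~ iset r nu i by move=> hi; have <- : r.-1 = i by lia.
apply: (@Anu_isoI _ _ (prod_ops (pow_ops A_ops N) B_ops)
  (fun P => (encAs r idx P, encB m P))).
- move=> P Q; split=> [h|[hA hB]].
    by rewrite (encAs_ext h) /encB; case: h => h _; rewrite h.
  split=> i hi hI; last by move: (ht' i hi); rewrite hI.
  have [hij|hij] := eqVneq i (mirror r i); last exact: encAs_inj.
  have -> : i = m by move: hij hjm; rewrite /mirror; lia.
  exact: encB_inj.
- by move=> P Q; rewrite encAs_add encB_add.
- by move=> P Q; rewrite encAs_mul (encB_mul _ _ hjm).
- by move=> a P; rewrite encAs_scl encB_scl.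
- by rewrite encAs_one encB_one.
- by move=> [x y]; exists (dec x y 0); rewrite encAs_dec encB_dec_mid.
Qed.

Lemma iso_ABC m : (m.+2 <= r)%N -> mirror r m = m -> iset r nu m -> iset r nu r.-1 ->
  Anu_iso r nu (prod_ops (prod_ops (pow_ops A_ops N) B_ops) C_ops).
Proof.
move=> hm hjm hIm ht; have r0 : (0 < r)%N by lia.
apply: (@Anu_isoI _ _ (prod_ops (prod_ops (pow_ops A_ops N) B_ops) C_ops)
  (fun P => (encAs r idx P, encB m P, cal (P r.-1)))).
- move=> P Q; split=> [h|[hA hB hC]].
    by rewrite (encAs_ext h) /encB; case: h => h h'; rewrite h // h' // prednK.
  split=> i hi hI; last by move: hC; rewrite -hi.
  have [hij|hij] := eqVneq i (mirror r i); last exact: encAs_inj.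
  have -> : i = m by move: hij hjm; rewrite /mirror; lia.
  exact: encB_inj.
- by move=> P Q; rewrite encAs_add encB_add.
- by move=> P Q; rewrite encAs_mul (encB_mul _ _ hjm).
- by move=> a P; rewrite encAs_scl encB_scl.
- by rewrite encAs_one encB_one.
- move=> [[x y] z]; exists (dec x y z).
  by rewrite encAs_dec encB_dec_mid // cal_dec // prednK.
Qed.

End Assemble.

(** * Orbit representatives and the count for each residue of r *)

Lemma reps_odd r nu : odd r -> (3 <= r)%N -> orbit_reps r nu ((r - 1) %/ 2) id id.
Proof.
move=> hr h3; split=> [l hl|i hi hij _]; first by split=> //; rewrite /iset /mirror ?hr; lia.
by exists i => //; move: hij; rewrite /mirror; lia.
Qed.

(** For even r only the i = 2l + nu occur, and i < r-2-i then reads 4l + 2nu + 2 < r. *)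
Lemma reps_even r (nu : bool) N : ~~ odd r -> (forall l, (l < N)%N = (4 * l + 2 * nu + 2 < r)%N) ->
  orbit_reps r nu N (fun l => 2 * l + nu)%N (fun i => i %/ 2)%N.
Proof.
move=> hr hN; split=> [l|i hi hij].
  by rewrite hN => hl; case: nu hN hl => hN /= hl; split; rewrite /iset /mirror; lia.
rewrite /iset (negPf hr) /= => /eqP hnu; exists (i %/ 2)%N.
  by move: hij; rewrite hN -hnu /mirror; lia.
by rewrite -hnu; lia.
Qed.

Theorem theorem7p2 (r : nat) :
  (* r in 3 + 2N *)
  ((odd r /\ (3 <= r)%N) ->
     Anu_iso r false (prod_ops (pow_ops A_ops ((r - 1) %/ 2)) C_ops) /\
     Anu_iso r true  (prod_ops (pow_ops A_ops ((r - 1) %/ 2)) C_ops)) /\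
  (* r in 2 + 4N *)
  ((r %% 4 = 2)%N ->
     Anu_iso r false (prod_ops (pow_ops A_ops ((r - 2) %/ 4)) B_ops) /\
     Anu_iso r true  (prod_ops (pow_ops A_ops ((r - 2) %/ 4)) C_ops)) /\
  (* r in 4 + 4N *)
  ((r %% 4 = 0 /\ (4 <= r))%N ->
     Anu_iso r false (pow_ops A_ops (r %/ 4)) /\
     Anu_iso r true  (prod_ops (prod_ops (pow_ops A_ops ((r - 4) %/ 4)) B_ops) C_ops)).
Proof.
split; [move=> [hr h3]|split; [move=> h4|move=> [h4 hr4]]].
(* For odd r the involution has no fixed point, and every index, r-1 included, occurs for both
   parities. *)
- by split; apply: (iso_AC (reps_odd _ hr h3)); rewrite /iset ?hr //;
    try lia; move=> i hi _; rewrite /mirror; lia.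
(* Here (r-2)/2 is even and r-1 is odd, so B and C fall to different parities. *)
- have hr : ~~ odd r by lia.
  split.
    apply: (iso_AB (reps_even (nu := false) hr _) (m := (r - 2) %/ 2)%N);
      rewrite /iset /mirror; lia.
  apply: (iso_AC (reps_even (nu := true) hr _)); rewrite /iset /mirror; lia.
(* Now (r-2)/2 and r-1 are both odd, so B and C fall to the same parity. *)
- have hr : ~~ odd r by lia.
  split.
    apply: (iso_A (reps_even (nu := false) hr _)); rewrite /iset /mirror; lia.
  apply: (iso_ABC (reps_even (nu := true) hr _) (m := (r - 2) %/ 2)%N);
    rewrite /iset /mirror; lia.
Qed.
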